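(* Let $2\le p\le q\le r\le\infty$ with $\frac1p+\frac1q+\frac1r<1$. If the triangle group $\Gamma(p,q,r)$ is not exceptional, i.e. it is not of the form $\Gamma(2,3,r)$ or $\Gamma(2,4,r)$, then the triangle group orbifold $\mathcal{O}(p,q,r)$ contains a figure eight geodesic.
   Context: Let $\mathbb{H}$ be the hyperbolic plane. Here $p,q,r$ are integers or $\infty$, with $1/\infty=0$. The triangle group $\Gamma(p,q,r)$ is the orientation-preserving index two subgroup of the discrete group generated by the reflections in the geodesics containing the sides of a hyperbolic triangle with interior angles $\frac{\pi}{p},\frac{\pi}{q},\frac{\pi}{r}$ (angle $0$, i.e. an ideal vertex, for the value $\infty$), and $\mathcal{O}(p,q,r)=\mathbb{H}/\Gamma(p,q,r)$, a sphere with three orbifold points of orders $p,q,r$, where order $\infty$ means a puncture. A triangle group is called exceptional if it has the form $\Gamma(2,3,r)$ or $\Gamma(2,4,r)$. A closed geodesic on $\mathcal{O}(p,q,r)$ is the projection of the axis of a hyperbolic element $g$ of $\Gamma(p,q,r)$, assumed primitive ($g$ is not a proper power). A figure eight geodesic is a closed geodesic that is disjoint from the orbifold points (projections of points of $\mathbb{H}$ with nontrivial stabilizer) and self-intersects exactly once, i.e. it has exactly one self-intersection point, which is a transverse double point. *)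

(* Defs.v *)
From HB Require Import structures.
From mathcomp Require Import all_boot all_order all_algebra.
From mathcomp Require Import all_classical all_reals all_analysis.
Set Implicit Arguments.
Unset Strict Implicit.
Unset Printing Implicit Defensive.
Import Order.TTheory GRing.Theory Num.Theory.
Local Open Scope classical_set_scope.
Local Open Scope ring_scope.

(* The hyperbolic plane is the hyperboloid model in Minkowski space: column
   vectors with the form mdot x y = - x0 y0 + x1 y1 + x2 y2.  Its isometries
   are the restrictions of the linear isometries of the form that preserve the
   upper sheet (no sign ambiguity, unlike with PSL_2), and an isometry preserves
   orientation iff its determinant is positive. *)
Section Hyperboloid.
Variable R : realType.
Implicit Types (x y z n u v w a b c : 'cV[R]_3) (g h : 'M[R]_3).
Implicit Types (S G : set 'M[R]_3).

Definition minkowski : 'M[R]_3 := diag_mx (\row_i (-1) ^+ (i == 0)).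

Definition mdot x y : R := (x^T *m minkowski *m y) 0 0.

Lemma mdotE x y :
  mdot x y = - (x 0 0 * y 0 0) + x 1 0 * y 1 0 + x ord_max 0 * y ord_max 0.
Proof.
rewrite /mdot /minkowski mul_mx_diag mxE !big_ord_recl big_ord0 !mxE /=.
by rewrite !(eqxx, expr1, expr0, mulr1, mulrN, mulrN1, mulNr, addr0) addrA;
  congr (_ + x _ _ * y _ _ + x _ _ * y _ _); apply/val_inj.
Qed.

Definition hplane : set 'cV[R]_3 := [set x | mdot x x = -1 /\ 0 < x 0 0].

(* The circle at infinity is the set of future lightlike vectors up to positive
   scaling. *)
Definition ideal : set 'cV[R]_3 := [set x | mdot x x = 0 /\ 0 < x 0 0].

Definition same_ideal u v : Prop := exists2 k : R, 0 < k & v = k *: u.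

(* A spacelike vector n encodes the geodesic [set x | hplane x /\ mdot x n = 0];
   a point of [hplane `|` ideal] lies on it, or is an endpoint of it, iff it is
   orthogonal to n. *)
Definition normal_through a b n : Prop :=
  [/\ 0 < mdot n n, mdot a n = 0 & mdot b n = 0].

Definition reflection n : 'M[R]_3 :=
  1%:M - (2 / mdot n n) *: (n *m n^T *m minkowski).

Lemma reflectionE n x :
  reflection n *m x = x - (2 * mdot n x / mdot n n) *: n.
Proof.
rewrite /reflection mulmxBl mul1mx -scalemxAl -!mulmxA (mulmxA n^T).
rewrite [n^T *m _ *m x]mx11_scalar -/(mdot n x) mul_mx_scalar scalerA.
by rewrite mulrAC.
Qed.

(* Initial velocity at the point x of the geodesic towards y; meaningful for y
   in [hplane] as well as for y in [ideal]. *)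
Definition direction x y : 'cV[R]_3 := y + mdot x y *: x.

Definition angle x y z : R :=
  let v := direction x y in let w := direction x z in
  acos (mdot v w / (Num.sqrt (mdot v v) * Num.sqrt (mdot w w))).

Definition order_inv (p : \bar int) : R :=
  if p is EFin k then k%:~R^-1 else 0.

Definition vertex_of_order (p : \bar int) a b c : Prop :=
  if p is EFin k then hplane a /\ angle a b c = pi / k%:~R else ideal a.

Definition hyperbolic_triangle (p q r : \bar int) a b c : Prop :=
  [/\ vertex_of_order p a b c, vertex_of_order q b c a,
      vertex_of_order r c a b
    & ~ exists2 n, normal_through a b n & mdot c n = 0].

Definition is_subgroup G : Prop :=
  [/\ G 1%:M, forall g h, G g -> G h -> G (g *m h)
    & forall g, G g -> G (invmx g)].

Definition generated S : set 'M[R]_3 := smallest is_subgroup S.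

Definition side_reflections a b c : set 'M[R]_3 :=
  [set reflection n | n in normal_through a b `|` normal_through b c
                           `|` normal_through c a].

Definition triangle_group a b c : set 'M[R]_3 :=
  [set g | generated (side_reflections a b c) g /\ 0 < \det g].

(* The point of the quotient space hplane / G represented by x, as an orbit. *)
Definition proj G x : set 'cV[R]_3 := [set h *m x | h in G].

Definition orbifold_point G : set (set 'cV[R]_3) :=
  [set proj G x | x in [set x | hplane x /\
     exists2 h, G h & h <> 1%:M /\ h *m x = x]].

Definition fixes_ideal g u : Prop := ideal u /\ same_ideal u (g *m u).

Definition fixes_exactly g u v : Prop :=
  [/\ ideal u, ideal v, ~ same_ideal u v
    & forall w, fixes_ideal g w <-> same_ideal u w \/ same_ideal v w].

(* For orientation preserving isometries only: a reflection also has two fixed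
   points at infinity. *)
Definition hyperbolic g : Prop := exists u v, fixes_exactly g u v.

Definition axis g : set 'cV[R]_3 :=
  [set x | hplane x /\
     exists u v, fixes_exactly g u v /\ exists s t, x = s *: u + t *: v].

Definition primitive G g : Prop :=
  ~ exists2 h, G h & exists2 m : nat, (1 < m)%N & g = h ^+ m.

(* The closed geodesic of g is the loop axis g / <g> -> hplane / G.  The branches
   of this loop at P are the points of axis g / <g> lying over P. *)
Definition branches G g (P : set 'cV[R]_3) : set (set 'cV[R]_3) :=
  [set proj (generated [set g]) x | x in [set x | axis g x /\ proj G x = P]].

Definition self_intersection G g : set (set 'cV[R]_3) :=
  [set P | exists B1 B2 : set 'cV[R]_3,
     [/\ branches G g P B1, branches G g P B2 & B1 <> B2]].

Definition double_point G g (P : set 'cV[R]_3) : Prop :=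
  exists B1 B2 : set 'cV[R]_3, B1 <> B2 /\ branches G g P = [set B1; B2].

(* If h maps the point x of the axis to the point y of the axis, the two branches
   at their common projection lift to the geodesics h (axis g) and axis g through
   y; two geodesics through y are transverse iff they are distinct. *)
Definition transverse_at G g (P : set 'cV[R]_3) : Prop :=
  forall x y h, axis g x -> axis g y -> proj G x = P -> G h -> y = h *m x ->
    proj (generated [set g]) x <> proj (generated [set g]) y ->
    [set h *m z | z in axis g] <> axis g.

Definition figure_eight G g : Prop :=
  [/\ G g, hyperbolic g, primitive G g,
      forall x, axis g x -> ~ orbifold_point G (proj G x)
    & exists P, [/\ self_intersection G g = [set P], double_point G g P
                  & transverse_at G g P]].

End Hyperboloid.

Definition exceptional (p q r : \bar int) : Prop :=
  p = 2%:E /\ (q = 3%:E \/ q = 4%:E).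

(* Main.v *)
(* The triangle is the chamber of the group generated by the reflections in its
   sides; by Tits' positivity theorem for words of minimal length, two points of
   the chamber in one orbit coincide, and a point on a single side is fixed only
   by the reflection in that side.  For two vertices b, c reflect the side ca in
   the side bc.  The product g of the reflections in ab and in this image is a
   hyperbolic element whose axis is their common perpendicular.  If the feet are
   interior to the sides, half a period of the axis is folded into the triangle
   as a path that leaves ab perpendicularly, is reflected in bc and meets ca
   perpendicularly.  So the axis meets each orbit only along its own
   infinite dihedral stabilizer, except at the point where it crosses bc, which
   gives the double point.  The feet are interior for the vertices of the two
   largest orders, except for orders 3, 3, r, where the two vertices of order 3
   work. *)
Require Import Defs.
From mathcomp Require Import all_boot all_order all_algebra.
From mathcomp Require Import all_classical all_reals all_analysis.
From mathcomp Require Import ring lra zify.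
Import Order.TTheory GRing.Theory Num.Theory.
Local Open Scope ring_scope.
Set Implicit Arguments.
Unset Strict Implicit.
Unset Printing Implicit Defensive.

(** * Minkowski space *)

Section Minkowski.
Variable R : realType.
Implicit Types (x y z n u v w : 'cV[R]_3) (g h : 'M[R]_3) (k : R).

(** Tits' theorem speaks of points of the triangle, but the axis leaves the triangle through bc, so
    both ends of every identification must be folded back by [rho], the reflection in bc. A folded
    and an unfolded point cannot be confused, because the axis is not perpendicular to bc. The
    reflection [rho] fixes the crossing point Z but is not in the triangle group. The reflection
    [sig] in ab preserves the axis and also reverses orientation, so [rho *m sig] is in the group
    and takes [sig *m Z] to Z. These two points differ modulo powers of [g] and give the two
    branches. Let [x], [y], [z] be the cosines of the angles at a, b, c. The unit normals of ab and
    of the image of ca have product [- k] with [k = x + 2 * y * z], and a common perpendicular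
    exists when [1 < k]. For p = 2 we have [x = 0], and the feet are interior only if
    [1 / 2 < y ^+ 2] and [1 / 2 < z ^+ 2], that is, both orders exceed 4; this is where the
    exceptional groups drop out. For orders 3, 3, r the condition [z < k * y] would read
    [z < 1 / 2], which is false. *)

Lemma mdotC x y : mdot x y = mdot y x.
Proof. by rewrite !mdotE; ring. Qed.

Lemma mdotDl x y z : mdot (x + y) z = mdot x z + mdot y z.
Proof. by rewrite !mdotE !mxE; ring. Qed.

Lemma mdotZl k x y : mdot (k *: x) y = k * mdot x y.
Proof. by rewrite !mdotE !mxE; ring. Qed.

Lemma mdotNl x y : mdot (- x) y = - mdot x y.
Proof. by rewrite !mdotE !mxE; ring. Qed.

Lemma mdotDr x y z : mdot z (x + y) = mdot z x + mdot z y.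
Proof. by rewrite !(mdotC z) mdotDl. Qed.

Lemma mdotZr k x y : mdot y (k *: x) = k * mdot y x.
Proof. by rewrite !(mdotC y) mdotZl. Qed.

Lemma mdotNr x y : mdot y (- x) = - mdot y x.
Proof. by rewrite !(mdotC y) mdotNl. Qed.

Lemma mdot0l x : mdot 0 x = 0.
Proof. by rewrite -(scale0r x) mdotZl mul0r. Qed.

Definition mdot_lin := (mdotDl, mdotDr, mdotZl, mdotZr, mdotNl, mdotNr).

Lemma colvec3P x y :
  x 0 0 = y 0 0 -> x 1 0 = y 1 0 -> x ord_max 0 = y ord_max 0 -> x = y.
Proof.
move=> e0 e1 e2; apply/matrixP => i j; rewrite (ord1 j).
case: i => [[|[|[|//]]] hi].
- by rewrite (_ : Ordinal hi = 0) //; apply/val_inj.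
- by rewrite (_ : Ordinal hi = 1) //; apply/val_inj.
- by rewrite (_ : Ordinal hi = ord_max) //; apply/val_inj.
Qed.

Lemma eq_mulmx_col g h : (forall x, g *m x = h *m x) -> g = h.
Proof.
move=> gh; apply/matrixP => i j.
have /matrixP/(_ i 0) := gh (delta_mx j 0).
by rewrite -!colE !mxE.
Qed.

Lemma reflection_unit n x :
  mdot n n = 1 -> reflection n *m x = x - (2 * mdot n x) *: n.
Proof. by move=> nn; rewrite reflectionE nn divr1. Qed.

Lemma reflectionK n : mdot n n = 1 -> reflection n *m reflection n = 1%:M.
Proof.
move=> nn; apply: eq_mulmx_col => x; rewrite -mulmxA mul1mx !reflection_unit//.
rewrite !mdot_lin nn; apply/matrixP => i j; rewrite !mxE; ring.
Qed.

Lemma reflectionZ k n : k != 0 -> mdot n n != 0 ->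
  reflection (k *: n) = reflection n.
Proof.
move=> k0 nn; apply: eq_mulmx_col => x; rewrite !reflectionE !mdot_lin scalerA.
by congr (_ - _ *: _); field; rewrite k0 nn.
Qed.

Lemma reflection_fix n x : mdot n n = 1 -> mdot n x = 0 -> reflection n *m x = x.
Proof. by move=> nn nx; rewrite reflection_unit// nx mulr0 scale0r subr0. Qed.

Lemma det_mx3 g : \det g =
   g 0 0 * (g 1 1 * g ord_max ord_max - g 1 ord_max * g ord_max 1)
 - g 0 1 * (g 1 0 * g ord_max ord_max - g 1 ord_max * g ord_max 0)
 + g 0 ord_max * (g 1 0 * g ord_max 1 - g 1 1 * g ord_max 0).
Proof.
have det2 (A : 'M[R]_2) : \det A = A 0 0 * A 1 1 - A 0 1 * A 1 0.
  rewrite (expand_det_row _ ord0) !big_ord_recl big_ord0 /cofactor !det_mx11 !mxE /=.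
  rewrite (_ : lift ord0 ord0 = 1); last exact/val_inj.
  rewrite (_ : lift 1 0 = 0); last exact/val_inj.
  by rewrite /bump /=; ring.
pose G i j := g (inord i) (inord j).
have E i j : g i j = G i j by rewrite /G !inord_val.
rewrite (expand_det_row _ ord0) !big_ord_recl big_ord0 /cofactor !det2 !mxE /=.
by rewrite !E /= /bump /=; ring.
Qed.

Lemma det_reflection n : mdot n n = 1 -> \det (reflection n) = -1.
Proof.
move=> nn.
have E i j : reflection n i j = (i == j)%:R - 2 * n i 0 * n j 0 * (-1) ^+ (j == 0).
  rewrite /reflection nn divr1 /minkowski -mulmxA mul_mx_diag !mxE big_ord1 !mxE.
  by ring.
have -> : \det (reflection n) = 1 - 2 * mdot n n.
  by rewrite det_mx3 !E mdotE /= ?expr1 ?expr0; ring.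
by rewrite nn; ring.
Qed.

Definition lorentz g := forall x y, mdot (g *m x) (g *m y) = mdot x y.

Lemma lorentz1 : lorentz 1%:M.
Proof. by move=> x y; rewrite !mul1mx. Qed.

Lemma lorentzM g h : lorentz g -> lorentz h -> lorentz (g *m h).
Proof. by move=> ig ih x y; rewrite -!mulmxA ig ih. Qed.

Lemma reflection_lorentz n : mdot n n = 1 -> lorentz (reflection n).
Proof.
move=> nn x y; rewrite !reflection_unit// !mdot_lin nn (mdotC x n); ring.
Qed.

Lemma reflection_conj g n : lorentz g -> mdot n n = 1 ->
  reflection (g *m n) *m g = g *m reflection n.
Proof.
move=> ig nn; apply: eq_mulmx_col => x.
rewrite -!mulmxA !reflection_unit ?ig// mulmxBr.
by congr (_ - _); rewrite scalemxAr.
Qed.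

(** Covers finite and ideal vertices at once. *)
Definition causal x := mdot x x <= 0 /\ 0 < x 0 0.

Lemma hplane_causal x : hplane x -> causal x.
Proof. by move=> [xx x0]; split=> //; rewrite xx; lra. Qed.

Lemma ideal_causal x : ideal x -> causal x.
Proof. by move=> [xx x0]; split=> //; rewrite xx. Qed.

(* The vector [y 0 0 *: x - x 0 0 *: y] is horizontal, hence spacelike. *)
Lemma causal_mdot_lt x y : causal x -> causal y -> y 0 0 *: x <> x 0 0 *: y ->
  mdot x y < 0 /\ mdot x x * mdot y y < mdot x y ^+ 2.
Proof.
move=> [xx x0] [yy y0] ne; pose d := y 0 0 *: x - x 0 0 *: y.
have d0 : d 0 0 = 0 by rewrite !mxE; ring.
have dd : 0 < mdot d d.
  rewrite mdotE d0 mul0r oppr0 add0r -!expr2 lt_neqAle addr_ge0 ?sqr_ge0// andbT.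
  rewrite eq_sym paddr_eq0 ?sqr_ge0// !sqrf_eq0; apply/negP => /andP[/eqP d1 /eqP d2].
  by apply/ne/eqP; rewrite -subr_eq0; apply/eqP/colvec3P; rewrite ?d0 ?d1 ?d2 mxE.
rewrite /d !mdot_lin (mdotC y x) in dd.
set X := x 0 0 in x0 dd; set Y := y 0 0 in y0 dd.
set A := mdot x x in xx dd *; set B := mdot y y in yy dd *; set C := mdot x y in dd *.
have XY : 0 < X * Y by exact: mulr_gt0.
have P : 0 <= Y ^+ 2 * - A by rewrite mulr_ge0 ?sqr_ge0// oppr_ge0.
have Q : 0 <= X ^+ 2 * - B by rewrite mulr_ge0 ?sqr_ge0// oppr_ge0.
have C0 : C < 0 by rewrite -(pmulr_rlt0 _ XY); lra.
split=> //; rewrite -(ltr_pM2l (exprn_gt0 2 XY)).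
(* This is [dd] squared; the left side is at least [4 * X ^+ 2 * Y ^+ 2 * A * B] by the inequality
   of arithmetic and geometric means. *)
have : (Y ^+ 2 * - A + X ^+ 2 * - B) ^+ 2 < (- (2 * (X * Y) * C)) ^+ 2.
  by rewrite ltr_pXn2r// ?nnegrE; lra.
have := sqr_ge0 (Y ^+ 2 * A - X ^+ 2 * B); lra.
Qed.

Lemma ideal_orthogonal u v : ideal u -> ideal v -> mdot u v = 0 -> same_ideal u v.
Proof.
move=> iu iv uv; have [uu u0] := iu; have [vv v0] := iv.
have [e|ne] := pselect (v 0 0 *: u = u 0 0 *: v); last first.
  by have [] := causal_mdot_lt (ideal_causal iu) (ideal_causal iv) ne; rewrite uv; lra.
exists (v 0 0 / u 0 0); first exact: divr_gt0.
by rewrite mulrC -scalerA e scalerA mulVf ?gt_eqF// scale1r.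
Qed.

(** Time coordinates of opposite signs would force the spatial product to exceed their product in
    absolute value, against Cauchy-Schwarz. This is how reflections are seen to preserve the upper
    sheet. *)
Lemma same_sheet x y : mdot x x <= 0 -> mdot y y <= 0 -> mdot x y < 0 ->
  0 < x 0 0 * y 0 0.
Proof.
rewrite !mdotE; set x0 := x 0 0; set x1 := x 1 0; set x2 := x ord_max 0.
set y0 := y 0 0; set y1 := y 1 0; set y2 := y ord_max 0 => xx yy xy.
rewrite ltNge; apply/negP => neg.
have : (x0 * y0) ^+ 2 < (x1 * y1 + x2 * y2) ^+ 2 by nra.
have := sqr_ge0 (x1 * y2 - x2 * y1).
have : (x1 * x1 + x2 * x2) * (y1 * y1 + y2 * y2) <= x0 * x0 * (y0 * y0).
  by apply: ler_pM; nra.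
lra.
Qed.

Lemma reflection_hplane n x : mdot n n = 1 -> hplane x -> hplane (reflection n *m x).
Proof.
move=> nn [xx x0]; split; first by rewrite reflection_lorentz.
rewrite -(pmulr_rgt0 _ x0); apply: same_sheet.
- by rewrite xx; lra.
- by rewrite reflection_lorentz// xx; lra.
- rewrite reflection_unit// !mdot_lin xx (mdotC x n).
  by have := sqr_ge0 (mdot n x); nra.
Qed.

End Minkowski.

(** * Linear Coxeter groups *)

Section ReflectionGroup.
Variable R : realType.
Implicit Types (x y s t a b : 'cV[R]_3) (g h : 'M[R]_3) (u v w d : seq 'cV[R]_3).

Definition act w : 'M[R]_3 := foldr (fun n g => reflection n *m g) 1%:M w.

Lemma act_cons n w : act (n :: w) = reflection n *m act w. Proof. by []. Qed.

Lemma act_cat v w : act (v ++ w) = act v *m act w.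
Proof. by elim: v => [|n v IH] /=; rewrite ?mul1mx// IH mulmxA. Qed.

Lemma act_seq1 n : act [:: n] = reflection n.
Proof. by rewrite /act /= mulmx1. Qed.

Lemma act_rcons w n : act (rcons w n) = act w *m reflection n.
Proof. by rewrite -cats1 act_cat act_seq1. Qed.

Definition dihedral_pair s t := mdot s t = -1 \/
  exists2 m : nat, (2 <= m)%N & mdot s t = - cos (pi / m%:R).

Lemma dihedral_pairC s t : dihedral_pair s t -> dihedral_pair t s.
Proof. by rewrite /dihedral_pair mdotC. Qed.

(** With th = pi / m, [f k] is sin (k th) / sin th, degenerating to [k] at an ideal vertex: the
    coefficients of the roots of a dihedral group. The values at [m] and [m.-1] carry the braid
    relation. *)
Lemma dihedral_coefficients s t : dihedral_pair s t ->
  exists f : nat -> R, [/\ f 0%N = 0, f 1%N = 1,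
    forall k, f k.+2 = - (2 * mdot s t) * f k.+1 - f k &
    (forall k, 0 <= f k) \/
    exists m, [/\ (2 <= m)%N, forall k, (k <= m)%N -> 0 <= f k,
                 f m = 0 & f m.-1 = 1]].
Proof.
case=> [->|[m m2 ->]].
  exists (fun k => k%:R); split=> //.
    by move=> k; rewrite -addn2 -addn1 !natrD; ring.
  by left=> k; rewrite ler0n.
set th := pi / m%:R.
have m0 : 0 < m%:R :> R by rewrite ltr0n; lia.
have th0 : 0 < th by rewrite divr_gt0// pi_gt0.
have mth : m%:R * th = pi by rewrite /th mulrC divfK// gt_eqF.
have thpi : th < pi.
  rewrite -mth -[ltLHS]mul1r ltr_pM2r// (_ : 1 = 1%:R)// ltr_nat; lia.
have s0 : 0 < sin th by apply: sin_gt0_pi; rewrite th0 thpi.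
exists (fun k => sin (k%:R * th) / sin th); split=> //.
- by rewrite mul0r sin0 mul0r.
- by rewrite mul1r divff// gt_eqF.
- move=> k.
  have -> : k.+2%:R * th = k.+1%:R * th + th.
    by rewrite -(addn1 k.+1) natrD; ring.
  have -> : sin (k%:R * th) = sin (k.+1%:R * th - th).
    by congr sin; rewrite -(addn1 k) natrD; ring.
  by rewrite sinD sinB; field; rewrite gt_eqF.
- right; exists m; split=> //.
  + move=> k km; apply: divr_ge0; last exact: ltW.
    apply: sin_ge0_pi; apply/andP; split; first by apply: mulr_ge0 => //; exact: ltW.
    by rewrite -mth; apply: ler_wpM2r; [exact: ltW|rewrite ler_nat].
  + by rewrite mth sinpi mul0r.
  + have -> : m.-1%:R * th = pi - th.
      by rewrite -mth -{2}(prednK (ltnW m2)) -addn1 natrD; ring.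
    by rewrite sinB sinpi cospi; field; rewrite gt_eqF.
Qed.

Fixpoint alternating_word a b k : seq 'cV[R]_3 :=
  if k is k'.+1 then a :: alternating_word b a k' else [::].

Lemma alternating_wordSr a b k : alternating_word a b k.+1 =
  rcons (alternating_word a b k) (if odd k then b else a).
Proof.
elim: k a b => //= k IH a b; congr (_ :: _).
by move: (IH b a) => /= ->; case: (odd k).
Qed.

Lemma alternating_wordD a b j k : exists w,
  alternating_word a b (j + k) = alternating_word a b j ++ w.
Proof.
elim: j a b => [|j IH] a b; first by exists (alternating_word a b k).
by have [w e] := IH b a; exists w; rewrite addSn /= e.
Qed.

Lemma alternating_wordE a b (f : nat -> R) k :
  mdot a a = 1 -> mdot b b = 1 ->
  f 0%N = 0 -> f 1%N = 1 ->
  (forall k, f k.+2 = - (2 * mdot a b) * f k.+1 - f k) ->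
  act (alternating_word a b k) *m (if odd k then b else a) =
  f k.+1 *: a + f k *: b.
Proof.
move=> + + f0 f1; elim: k a b => [|k IH] a b aa bb fS.
  by rewrite /= mul1mx f0 f1 scale1r scale0r addr0.
rewrite [alternating_word _ _ _]/= act_cons -mulmxA.
rewrite (_ : (if odd k.+1 then b else a) = if odd k then a else b); last first.
  by rewrite /=; case: (odd k).
rewrite IH//; last by move=> j; rewrite fS (mdotC a).
rewrite reflection_unit// fS !mdot_lin aa.
by apply/matrixP => i j; rewrite !mxE; ring.
Qed.

(** * Reduced words and Tits' positivity theorem *)

Variable S : seq 'cV[R]_3.
Hypothesis unitS : {in S, forall s, mdot s s = 1}.
Hypothesis dihedralS : {in S &, forall s t, s != t -> dihedral_pair s t}.

Definition word w := all (mem S) w.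

Definition reduced w :=
  word w /\ forall w', word w' -> act w' = act w -> (size w <= size w')%N.

Definition chamber x := forall s, s \in S -> 0 <= mdot s x.

(** A weak form of positive root: tested on the chamber instead of by coefficients over [S]. *)
Definition positive y := forall x, chamber x -> 0 <= mdot y x.

Lemma act_lorentz w : word w -> lorentz (act w).
Proof.
elim: w => [_|s w IH /= /andP[sS wS]]; first exact: lorentz1.
by apply: lorentzM; [exact/reflection_lorentz/unitS|exact: IH].
Qed.

Lemma det_act w : word w -> \det (act w) = (-1) ^+ size w.
Proof.
elim: w => [_|s w IH /= /andP[sS wS]]; first by rewrite det1.
by rewrite det_mulmx IH// det_reflection ?unitS// exprS.
Qed.

Lemma odd_size_act v w : word v -> word w -> act v = act w ->
  odd (size v) = odd (size w).
Proof.
move=> vS wS e; have := det_act vS; rewrite e det_act// -signr_odd -[RHS]signr_odd.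
by move=> {e}; case: (odd (size v)); case: (odd (size w)) => //=;
  rewrite ?expr0 ?expr1; lra.
Qed.

Lemma act_revK w : word w -> act (rev w) *m act w = 1%:M.
Proof.
elim: w => [_|s w IH /= /andP[sS wS]]; first by rewrite mul1mx.
rewrite rev_cons act_rcons -mulmxA (mulmxA (reflection s)).
by rewrite reflectionK ?unitS// mul1mx IH.
Qed.

Lemma word_cat v w : word (v ++ w) = word v && word w.
Proof. exact: all_cat. Qed.

Lemma word_rcons w s : word (rcons w s) = (s \in S) && word w.
Proof. by rewrite /word all_rcons. Qed.

Lemma reduced_catl v w : reduced (v ++ w) -> reduced v.
Proof.
move=> []; rewrite word_cat => /andP[vS wS] H; split=> // v' v'S e.
have /H : word (v' ++ w) by rewrite word_cat v'S.
by rewrite !act_cat e !size_cat leq_add2r => /(_ erefl).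
Qed.

Lemma reduced_catr v w : reduced (v ++ w) -> reduced w.
Proof.
move=> []; rewrite word_cat => /andP[vS wS] H; split=> // v' v'S e.
have /H : word (v ++ v') by rewrite word_cat v'S vS.
by rewrite !act_cat e !size_cat leq_add2l => /(_ erefl).
Qed.

Lemma reduced_rconsl w s : reduced (rcons w s) -> reduced w.
Proof. by rewrite -cats1; exact: reduced_catl. Qed.

Lemma reduced_eq w w' : reduced w -> word w' -> act w' = act w ->
  (size w' <= size w)%N -> reduced w'.
Proof.
move=> [wS H] w'S e le; split=> // v vS ev.
by apply: leq_trans le _; apply: H; rewrite // ev.
Qed.

Lemma not_reduced_square s w : ~ reduced [:: s, s & w].
Proof.
move=> [/= /and3P[sS _ wS] /(_ w wS)].
rewrite mulmxA reflectionK ?unitS// mul1mx => /(_ erefl); lia.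
Qed.

Lemma reduced_alternating s t d : s != t -> {subset d <= [:: s; t]} -> reduced d ->
  exists a b, ((a = s /\ b = t) \/ (a = t /\ b = s)) /\
    d = alternating_word a b (size d).
Proof.
move=> st; elim: d => [_ _|c d IH sub rd].
  by exists s, t; split=> //; left.
have [a [b [ab e]]] := IH (fun z zd => sub z (mem_behead (s := c :: d) zd))
  (reduced_catr (v := [:: c]) rd).
have /sub : c \in c :: d by rewrite inE eqxx.
rewrite !inE => /orP cst.
have [/eqP d0|d0] := boolP (size d == 0%N).
  case: cst => /eqP ->; [exists s, t|exists t, s]; rewrite /= d0; split=> //;
    [by left| |by right|]; by rewrite (size0nil d0).
suff cb : c = b.
  by exists b, a; split; [case: ab => -[-> ->]; [right|left]|rewrite /= -e cb].
have ca : c <> a.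
  move: rd; rewrite e; case: (size d) d0 => //= k _ + ca; rewrite ca.
  exact: not_reduced_square.
by case: ab cst => -[ea eb] [] /eqP ec; rewrite ?ea ?eb ?ec // in ca *.
Qed.

(** A negative coefficient needs a word of more than m letters, and by the braid relation an
    alternating word of m + 1 letters is not reduced. *)
Lemma alternating_positive a b k : a \in S -> b \in S -> a != b ->
  reduced (alternating_word a b k.+1) ->
  exists p q : R, [/\ 0 <= p, 0 <= q &
  act (alternating_word a b k) *m (if odd k then b else a) = p *: a + q *: b].
Proof.
move=> aS bS ab red; have aa := unitS aS; have bb := unitS bS.
have [f [f0 f1 fS fP]] := dihedral_coefficients (dihedralS aS bS ab).
exists (f k.+1), (f k).
suff [? ?] : 0 <= f k.+1 /\ 0 <= f k by split=> //; exact: alternating_wordE.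
case: fP => [//|[m [m2 fge fm fm1]]].
have [km|mk] := leqP k.+1 m; first by split; apply: fge => //; exact: ltnW.
exfalso; have [w ew] := alternating_wordD a b m.+1 (k - m).
rewrite addSn subnKC// in ew; move: red; rewrite ew => /reduced_catl.
case: m m2 {fge mk w ew} fm fm1 => // m m2 fm fm1 [+ H].
have fS' j : f j.+2 = - (2 * mdot b a) * f j.+1 - f j by rewrite fS (mdotC a).
have := alternating_wordE m bb aa f0 f1 fS'; rewrite fm [m.+1.-1]/= in fm1 *.
rewrite fm1 scale0r add0r scale1r.
move: H; rewrite [alternating_word a b _]/= -/(alternating_word b a m.+1).
rewrite alternating_wordSr; set l := if odd m then a else b.
set d := alternating_word b a m => H dl /=; rewrite word_rcons => /and3P[_ lS dS].
(* As [act d] sends [l] to [a], the two end letters cancel and the word shortens by two. *)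
have : act d = act (a :: rcons d l).
  rewrite act_cons act_rcons -reflection_conj ?unitS//; last exact: act_lorentz.
  by rewrite dl mulmxA reflectionK// mul1mx.
move/(H _ dS); rewrite /= size_rcons; lia.
Qed.

(* [reduced (rcons w s)] says that [w] is reduced and that multiplying by
   [reflection s] increases the length; this is the key theorem on the geometric
   representation of a Coxeter group (Humphreys, Section 5.4).  The word [w] is
   rewritten as [v ++ d] with [d] in the rank two subgroup of [s] and the last
   letter of [w], and [v] as short as possible. *)
Lemma reduced_positive w s : reduced (rcons w s) -> positive (act w *m s).
Proof.
have [n] := ubnP (size w); elim: n w s => // n IH w s.
case/lastP: w => [_ [/andP[sS _] _]|w' t].
  by move=> x /(_ s sS); rewrite mul1mx.
set w := rcons w' t => sw red; have [wsS _] := red.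
have rw := reduced_rconsl red; have [wS wmin] := rw.
have sS : s \in S by move: wsS; rewrite word_rcons => /andP[].
have tS : t \in S by move: wS; rewrite word_rcons => /andP[].
have st : s != t.
  apply/eqP => st; apply: (@not_reduced_square s [::]); apply: (@reduced_catr w').
  by move: red; rewrite /w -st -!cats1 -catA.
pose P k := exists v d, [/\ word v, {subset d <= [:: s; t]},
  act w = act v *m act d, (size v + size d = size w)%N & size v = k].
have /ex_minnP[k /asboolP[v [d [vS dst e sz vk]]] kmin] : exists k, `[< P k >].
  exists (size w'); apply/asboolP; exists w', [:: t]; split=> //.
  - by move: wS; rewrite word_rcons => /andP[].
  - by move=> z; rewrite !inE => ->; rewrite orbT.
  - by rewrite act_rcons act_seq1.
  - by rewrite size_rcons addn1.
have dS : word d.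
  by apply/allP => z /dst; rewrite !inE => /orP[]/eqP->.
have vw : (size v < size w)%N.
  rewrite vk /w size_rcons ltnS; apply: kmin; apply/asboolP; exists w', [:: t]; split=> //.
  - by move: wS; rewrite word_rcons => /andP[].
  - by move=> z; rewrite !inE => ->; rewrite orbT.
  - by rewrite act_rcons act_seq1.
  - by rewrite size_rcons addn1.
have vst z : z \in [:: s; t] -> reduced (rcons v z).
  move=> zst; have zS : z \in S by move: zst; rewrite !inE => /orP[]/eqP->.
  split=> [|w1 w1S e1]; first by rewrite word_rcons zS.
  rewrite leqNgt; apply/negP => lt.
  have vzS : word (rcons v z) by rewrite word_rcons zS.
  (* Lengths of words for one element agree modulo 2, so a word shorter than [rcons v z] is also
     shorter than [v]; this will contradict the choice of [v]. *)
  have lt' : (size w1 < size v)%N.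
    move: lt; rewrite size_rcons ltnS leq_eqVlt => /orP[/eqP sz1|//].
    have := odd_size_act w1S vzS e1.
    by rewrite size_rcons sz1 /=; case: (odd _).
  have ew : act w = act w1 *m act (z :: d).
    rewrite e1 act_rcons act_cons -mulmxA (mulmxA (reflection z)).
    by rewrite reflectionK ?unitS// mul1mx.
  have le : (size w <= size w1 + (size d).+1)%N.
    have := wmin (w1 ++ z :: d); rewrite size_cat /=; apply; last by rewrite act_cat.
    by rewrite word_cat w1S /= zS.
  have : P (size w1).
    exists w1, (z :: d); split=> //.
    + by move=> y; rewrite inE => /orP[/eqP->//|/dst].
    + apply/eqP; rewrite eqn_leq le andbT /= -sz addnS -addSn.
      by rewrite leq_add2r.
  by move/asboolP/kmin; rewrite -vk leqNgt lt'.
have rds : reduced (rcons d s).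
  apply: (@reduced_catr v); apply: reduced_eq red _ _ _.
  - by rewrite word_cat vS word_rcons sS.
  - by rewrite act_cat (act_rcons d) (act_rcons w) e mulmxA.
  - by rewrite size_cat (size_rcons d) (size_rcons w) addnS sz.
have dsst : {subset rcons d s <= [:: s; t]}.
  move=> z; rewrite mem_rcons inE => /orP[/eqP->|/dst//].
  by rewrite inE eqxx.
have [a [b [ab eds]]] := reduced_alternating st dsst rds.
rewrite size_rcons in eds; have eds' := eds; rewrite alternating_wordSr in eds'.
have [ed es] := rcons_inj eds'.
have [aS bS abn] : [/\ a \in [:: s; t], b \in [:: s; t] & a != b].
  by case: ab => -[-> ->]; split; rewrite ?inE ?eqxx ?orbT// eq_sym.
have inS z : z \in [:: s; t] -> z \in S by rewrite !inE => /orP[]/eqP->.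
rewrite eds in rds.
have [p [q [p0 q0 epq]]] := alternating_positive (inS _ aS) (inS _ bS) abn rds.
rewrite -ed -es in epq; rewrite e -mulmxA epq mulmxDr -!scalemxAr => x xC.
rewrite !mdot_lin; have vn : (size v < n)%N by apply: leq_trans vw _.
by rewrite addr_ge0// mulr_ge0//; apply: IH => //; exact: vst.
Qed.

Lemma chamber_reduced w x : reduced w -> chamber x -> chamber (act w *m x) ->
  {in w, forall s, mdot s x = 0}.
Proof.
elim/last_ind: w => [//|w s IH] red xC wxC.
have [+ _] := red; rewrite word_rcons => /andP[sS wS].
have /(_ _ wxC) := reduced_positive red.
rewrite act_rcons -mulmxA act_lorentz// reflection_unit ?unitS//.
rewrite !mdot_lin unitS// => sx.
have sx0 : mdot s x = 0 by have := xC s sS; lra.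
move=> t; rewrite mem_rcons inE => /orP[/eqP->//|tw].
apply: IH => //; first exact: reduced_rconsl red.
by move: wxC; rewrite act_rcons -mulmxA reflection_fix ?unitS.
Qed.

Definition reflection_group := generated [set reflection s | s in [set` S]]%classic.

Lemma reflection_group_word g : reflection_group g -> exists2 w, word w & g = act w.
Proof.
move=> gW; apply: (gW [set g | exists2 w, word w & g = act w]%classic).
split; last first.
  by move=> _ [s sS <-]; exists [:: s]; rewrite ?act_seq1//= andbT.
split; first by exists [::].
- by move=> _ _ [v vS ->] [w wS ->]; exists (v ++ w); rewrite ?word_cat ?vS ?act_cat.
- move=> _ [w wS ->]; exists (rev w); first by rewrite /word all_rev.
  have wU : act w \in unitmx.
    by rewrite unitmxE det_act// unitrX// unitrN1.
  by rewrite -[RHS]mulmx1 -(mulmxV wU) mulmxA act_revK// mul1mx.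
Qed.

Lemma reflection_group_reduced g : reflection_group g ->
  exists2 w, reduced w & g = act w.
Proof.
move=> /reflection_group_word[w wS gw].
have /ex_minnP[k /asboolP[v [vS gv vk]] kmin] :
    exists k, `[< exists v, [/\ word v, g = act v & size v = k] >].
  by exists (size w); apply/asboolP; exists w.
exists v => //; split=> // v' v'S e; rewrite vk; apply: kmin; apply/asboolP.
by exists v'; rewrite e.
Qed.

Lemma chamber_fundamental g x : reflection_group g ->
  chamber x -> chamber (g *m x) ->
  {in S &, forall s t, mdot s x = 0 -> mdot t x = 0 -> s = t} ->
  g = 1%:M \/ exists s, [/\ s \in S, mdot s x = 0 & g = reflection s].
Proof.
move=> /reflection_group_reduced[w red ->] xC wxC uniq0.
have wx := chamber_reduced red xC wxC; have [wS _] := red.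
case: w red wx wS {wxC} => [|s [|t w]] red wx wS; first by left.
  right; exists s; rewrite act_seq1; split=> //; last by rewrite wx ?inE.
  by move: wS => /= /andP[].
exfalso; move: wS => /= /and3P[sS tS _].
have st : s = t by apply: uniq0; rewrite ?wx ?inE ?eqxx ?orbT.
by move: red; rewrite st; exact: not_reduced_square.
Qed.

End ReflectionGroup.

(** * Generated groups, powers and orbits *)

Local Notation proj := Defs.proj.

Lemma involution_expz (A : unitRingType) (s a : A) (j : int) :
  a \is a GRing.unit -> s * s = 1 -> s * a = a^-1 * s -> s * a ^ j = a ^ (- j) * s.
Proof.
move=> aU ss sa.
have sn (n : nat) : s * a ^ n = a ^ (- n%:Z) * s.
  elim: n => [|n IH]; first by rewrite oppr0 !expr0z mulr1 mul1r.
  have -> : a ^ (- n.+1%:Z) = a ^ (- n%:Z) * a^-1.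
    by rewrite -exprN1 -exprzDr//; congr (_ ^ _); lia.
  by rewrite exprSzr mulrA IH -!mulrA sa.
case: j => n; first exact: sn.
by rewrite NegzE opprK -[RHS]mul1r -ss -mulrA (mulrA s (a ^ _)) sn -mulrA ss mulr1.
Qed.

Section Generated.
Variable R : realType.
Implicit Types (A : set 'M[R]_3) (g h : 'M[R]_3).

Lemma generated_subgroup A : is_subgroup (generated A).
Proof.
split=> [G [[]]//|g h gA hA G GA|g gA G GA]; have [[_ GM GV] _] := GA.
  by apply: GM; [exact: gA|exact: hA].
by apply: GV; exact: gA.
Qed.

Lemma sub_generated A g : A g -> generated A g.
Proof. by move=> Ag G [_]; apply. Qed.

Lemma generated_min A G : is_subgroup G -> (A `<=` G)%classic ->
  (generated A `<=` G)%classic.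
Proof. by move=> GG AG g; apply. Qed.

Lemma expz_generated g (j : int) : generated [set g]%classic (g ^ j).
Proof.
have [G1 GM GV] := generated_subgroup [set g]%classic.
have Gn (n : nat) : generated [set g]%classic (g ^+ n).
  by elim: n => [|n IH]; rewrite ?exprS//; apply: GM => //; exact: sub_generated.
by case: j => n; [exact: Gn|exact: (GV _ (Gn n.+1))].
Qed.

Lemma generated_expz g h : g \is a GRing.unit -> generated [set g]%classic h ->
  exists j : int, h = g ^ j.
Proof.
move=> gU hg; apply: (hg [set h | exists j : int, h = g ^ j]%classic).
split; last by move=> _ ->; exists 1; rewrite expr1z.
split; first by exists 0; rewrite expr0z.
- by move=> _ _ [i ->] [j ->]; exists (i + j); rewrite exprzDr.
- by move=> _ [i ->]; exists (- i); rewrite -invr_expz.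
Qed.

Section Projections.
Variable G : set 'M[R]_3.
Hypotheses (Ggrp : is_subgroup G) (Gunit : forall h, G h -> h \in unitmx).

Lemma proj_refl (x : 'cV[R]_3) : proj G x x.
Proof. by exists 1%:M; [case: Ggrp|rewrite mul1mx]. Qed.

Lemma projP (x y : 'cV[R]_3) : proj G x = proj G y <-> exists2 h, G h & h *m x = y.
Proof.
have [_ GM GV] := Ggrp; split=> [e|[h Gh <-]].
  by have [h Gh hx] : proj G x y; [rewrite e; exact: proj_refl|exists h].
apply/seteqP; split=> _ [h' Gh' <-].
  exists (h' *m invmx h); first by apply: GM => //; exact: GV.
  by rewrite mulmxA -(mulmxA h') mulVmx ?mulmx1// Gunit.
by exists (h' *m h); [exact: GM|rewrite mulmxA].
Qed.

End Projections.

End Generated.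

(** * The figure eight around two vertices *)

(* [n1], [n2], [n3] are the inward unit normals of the sides bc, ca, ab, and [x],
   [y], [z] the cosines of the angles at a, b, c.  The geodesic [m] is the image
   of [n2] under the reflection in [n1]; it is at distance d from [n3], where
   k = cosh d, e = sinh d, mu = exp d, nu = exp (- d).  The lightlike vectors [u]
   and [v] are the endpoints of the common perpendicular of [n3] and [m], along
   which [g] translates by 2 d.  The four inequalities [zky], [ykz], [kxz], [kxy]
   say that the feet of this perpendicular are interior to the sides. *)
Section FigureEight.
Variable R : realType.
Variables (n1 n2 n3 m u v : 'cV[R]_3) (x y z k e mu nu lam : R).
Local Notation S := [:: n1; n2; n3].
Hypotheses (n11 : mdot n1 n1 = 1) (n22 : mdot n2 n2 = 1) (n33 : mdot n3 n3 = 1).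
Hypotheses (n12 : mdot n1 n2 = - z) (n13 : mdot n1 n3 = - y) (n23 : mdot n2 n3 = - x).
Hypotheses (d12 : dihedral_pair n1 n2) (d13 : dihedral_pair n1 n3)
  (d23 : dihedral_pair n2 n3).
Hypotheses (kE : k = x + 2 * y * z) (y0 : 0 <= y) (z0 : 0 <= z) (k1 : 1 < k).
Hypotheses (zky : z < k * y) (ykz : y < k * z).
Hypotheses (kxz : 1 < k * x + 2 * z ^+ 2) (kxy : 1 < k * x + 2 * y ^+ 2).
Hypothesis chamber_future : forall w, chamber S w -> 0 <= w 0 0.
Hypothesis n123_free : forall p q r,
  p *: n1 + q *: n2 + r *: n3 = 0 -> [/\ p = 0, q = 0 & r = 0].

Hypotheses (e0 : 0 < e) (ee : e ^+ 2 = k ^+ 2 - 1).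
Hypotheses (muE : mu = k + e) (nuE : nu = k - e) (lamE : lam = mu ^+ 2).
Hypothesis mE : m = n2 + (2 * z) *: n1.
(** [mu] and [nu] are the roots of [t ^+ 2 - 2 * k * t + 1], so [m + t *: n3] is lightlike exactly
    for these [t]; the minus sign makes the vectors future-directed. *)
Hypotheses (uE : u = - (m + mu *: n3)) (vE : v = - (m + nu *: n3)).

Local Notation pt a b := (a *: u + b *: v).
Variables rho sig tau g : 'M[R]_3.
Hypotheses (rhoE : rho = reflection n1) (sigE : sig = reflection n3).
Hypotheses (tauE : tau = reflection m) (gE : g = sig *m tau).
Local Notation W := (reflection_group S).

(** * Lightlike coordinates on the plane of the axis *)

Let munu : mu * nu = 1.
Proof. by rewrite muE nuE mulrC -subr_sqr ee subKr. Qed.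
Let mu1 : 1 < mu.
Proof. by move: k1 e0; rewrite muE; lra. Qed.
Let nu0 : 0 < nu.
Proof. by rewrite -(pmulr_rgt0 _ (lt_trans ltr01 mu1)) munu. Qed.
Let nu1 : nu < 1.
Proof. by rewrite -munu ltr_pMl. Qed.
Let lam1 : 1 < lam.
Proof. by rewrite lamE exprn_egt1. Qed.
Let lam0 : 0 < lam. Proof. exact: lt_trans lam1. Qed.
Let lamV : lam^-1 = nu ^+ 2.
Proof.
apply: (mulfI (lt0r_neq0 lam0)); rewrite mulfV ?gt_eqF// lamE.
by rewrite -exprMn munu expr1n.
Qed.

Let mn3 : mdot m n3 = - k.
Proof. by rewrite mE !mdot_lin n23 n13 kE; ring. Qed.
Let mm : mdot m m = 1.
Proof. by rewrite mE !mdot_lin (mdotC n2 n1) n12 n11 n22; ring. Qed.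
Let n1m : mdot n1 m = z.
Proof. by rewrite mE !mdot_lin n12 n11; ring. Qed.

Let uu : mdot u u = 0.
Proof.
by rewrite uE !mdot_lin (mdotC n3 m) mn3 mm n33 muE; move: ee; lra.
Qed.
Let vv : mdot v v = 0.
Proof.
by rewrite vE !mdot_lin (mdotC n3 m) mn3 mm n33 nuE; move: ee; lra.
Qed.
Let uv : mdot u v = - (2 * e ^+ 2).
Proof.
by rewrite uE vE !mdot_lin (mdotC n3 m) mn3 mm n33 muE nuE; move: ee; lra.
Qed.
Let uv_lt0 : mdot u v < 0.
Proof. by rewrite uv oppr_lt0 mulr_gt0// exprn_gt0. Qed.

Let ptDE a b : pt a b = - ((a + b) *: m + (a * mu + b * nu) *: n3).
Proof. by rewrite uE vE; apply/matrixP => i j; rewrite !mxE; ring. Qed.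

Let pt_inj a b c d : pt a b = pt c d -> a = c /\ b = d.
Proof.
move=> E; have uv0 : mdot u v != 0 by rewrite lt_eqF.
split; apply: (mulIf uv0).
- have : mdot v (pt a b) = mdot v (pt c d) by rewrite E.
  by rewrite !mdot_lin vv (mdotC v u) !mulr0 !addr0.
- have : mdot u (pt a b) = mdot u (pt c d) by rewrite E.
  by rewrite !mdot_lin uu !mulr0 !add0r.
Qed.

Let sig_pt a b : sig *m pt a b = pt b a.
Proof.
rewrite sigE !ptDE reflection_unit// !mdot_lin (mdotC n3 m) mn3 n33.
by apply/matrixP => i j; rewrite !mxE muE nuE; ring.
Qed.

Let tau_pt a b : tau *m pt a b = pt (lam^-1 * b) (lam * a).
Proof.
have h1 : lam^-1 * b + lam * a = (2 * k * (a * mu + b * nu) - (a + b)).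
  rewrite lamV lamE; have -> : 2 * k = mu + nu by rewrite muE nuE; ring.
  by rewrite -[a + b]mul1r -munu; ring.
have h2 : lam^-1 * b * mu + lam * a * nu = a * mu + b * nu.
  rewrite lamV lamE; have -> : nu ^+ 2 * b * mu = mu * nu * (b * nu) by ring.
  have -> : mu ^+ 2 * a * nu = mu * nu * (a * mu) by ring.
  by rewrite munu; ring.
rewrite tauE !ptDE h1 h2 reflection_unit// !mdot_lin mn3 mm.
by apply/matrixP => i j; rewrite !mxE muE nuE; ring.
Qed.

Let g_pt a b : g *m pt a b = pt (lam * a) (lam^-1 * b).
Proof. by rewrite gE -mulmxA tau_pt sig_pt. Qed.

Let det_sig : \det sig = -1. Proof. by rewrite sigE det_reflection. Qed.
Let det_g : \det g = 1.
Proof. by rewrite gE tauE det_mulmx det_sig det_reflection//; ring. Qed.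
Let g_unit : g \is a GRing.unit.
Proof. by rewrite unitmxE det_g unitr1. Qed.
Let sigK : sig *m sig = 1%:M. Proof. by rewrite sigE reflectionK. Qed.
Let rhoK : rho *m rho = 1%:M. Proof. by rewrite rhoE reflectionK. Qed.

Let gz_pt (j : int) a b : g ^ j *m pt a b = pt (lam ^ j * a) (lam ^ (- j) * b).
Proof.
have lamU : lam \is a GRing.unit by rewrite unitfE gt_eqF.
have gn (n : nat) c d : g ^+ n *m pt c d = pt (lam ^ n * c) (lam ^ (- n%:Z) * d).
  elim: n c d => [|n IH] c d; first by rewrite mul1mx !mul1r.
  rewrite exprSr -mulmxE -mulmxA g_pt IH; congr (_ *: _ + _ *: _).
    by rewrite mulrA exprSzr.
  by rewrite mulrA; congr (_ * _); rewrite -!invr_expz exprSz invfM mulrC.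
case: j => n; first exact: gn.
have gU : g ^+ n.+1 \in unitmx by exact: unitrX.
have -> : g ^ Negz n = (g ^+ n.+1)^-1 by [].
rewrite NegzE opprK; apply: (can_inj (mulKmx gU)).
rewrite gn mulmxA (mulmxV gU : g ^+ n.+1 *m (g ^+ n.+1)^-1 = 1%:M) mul1mx.
congr (_ *: _ + _ *: _).
  by rewrite mulrA -exprzDr// subrr mul1r.
by rewrite mulrA -exprzDr// addrC subrr mul1r.
Qed.

Let tauK : tau *m tau = 1%:M. Proof. by rewrite tauE reflectionK. Qed.

(** * The infinite dihedral symmetry of the axis *)

Let sig_gz (j : int) : sig *m g ^ j = g ^ (- j) *m sig.
Proof.
apply: involution_expz => //; rewrite -!mulmxE ?sigK//.
apply: (mulrI g_unit); rewrite [RHS]mulrA divrr// mul1r -mulmxE gE.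
by rewrite -!mulmxA (mulmxA sig sig) sigK mul1mx tauK mulmx1.
Qed.

(* The infinite dihedral group generated by [sig] and [tau]. *)
Let D h := exists j : int, h = g ^ j \/ h = g ^ j *m sig.

Let Dg j : D (g ^ j). Proof. by exists j; left. Qed.
Let D1 : D 1%:M. Proof. by rewrite -[1%:M](expr0z g). Qed.
Let D_g : D g. Proof. by rewrite -[g]expr1z. Qed.
Let Dsig : D sig. Proof. by exists 0; right; rewrite expr0z mul1mx. Qed.

Let DM h h' : D h -> D h' -> D (h *m h').
Proof.
move=> [i hi] [j hj].
case: hi => ->; case: hj => ->.
- by exists (i + j); left; rewrite exprzDr.
- by exists (i + j); right; rewrite exprzDr// mulmxA.
- by exists (i - j); right; rewrite -mulmxA sig_gz mulmxA exprzDr.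
- exists (i - j); left; rewrite -mulmxA (mulmxA sig) sig_gz -mulmxA sigK mulmx1.
  by rewrite exprzDr.
Qed.

Let Dtau : D tau.
Proof.
rewrite -[tau]mul1mx -sigK -mulmxA -gE; apply: DM; first exact: Dsig.
by rewrite -[g]expr1z.
Qed.

Let DV h : D h -> exists2 h', D h' & h' *m h = 1%:M /\ h *m h' = 1%:M.
Proof.
move=> [j [->|->]].
  exists (g ^ (- j)); first exact: Dg.
  by rewrite !mulmxE -!exprzDr// addNr subrr expr0z.
exists (g ^ j *m sig); first by exists j; right.
by rewrite -mulmxA (mulmxA sig) sig_gz -mulmxA sigK mulmx1 mulmxE -exprzDr// subrr expr0z.
Qed.

Let det_gz j : \det (g ^ j) = 1.
Proof.
have gn (n : nat) : \det (g ^+ n) = 1.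
  by elim: n => [|n IH]; rewrite ?det1// exprS -mulmxE det_mulmx det_g IH mulr1.
case: j => n; first exact: gn.
by rewrite NegzE -invr_expz detV gn invr1.
Qed.

Let D_pos h : D h -> 0 < \det h -> exists j : int, h = g ^ j.
Proof.
move=> [j [->|->]]; first by exists j.
by rewrite det_mulmx det_gz det_sig; lra.
Qed.

Let D_neg h : D h -> \det h < 0 -> exists j : int, h = g ^ j *m sig.
Proof.
move=> [j [->|->]]; last by exists j.
by rewrite det_gz; lra.
Qed.

Let D_pt h a b : D h -> 0 < a -> 0 < b ->
  exists a' b', [/\ 0 < a', 0 < b' & h *m pt a b = pt a' b'].
Proof.
move=> [j hj] a0 b0.
case: hj => ->; [exists (lam ^ j * a), (lam ^ (- j) * b)|exists (lam ^ j * b), (lam ^ (- j) * a)].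
  by rewrite gz_pt !mulr_gt0// exprz_gt0.
by rewrite -mulmxA sig_pt gz_pt !mulr_gt0// exprz_gt0.
Qed.

Let WM h h' : W h -> W h' -> W (h *m h').
Proof. by have [_ + _] := generated_subgroup [set reflection s | s in [set` S]]%classic; apply. Qed.

Let W_refl s : s \in S -> W (reflection s).
Proof. by move=> sS; apply: sub_generated; exists s. Qed.

Let W_rho : W rho. Proof. rewrite rhoE; by apply: W_refl; rewrite !inE eqxx. Qed.
Let W_sig : W sig. Proof. rewrite sigE; by apply: W_refl; rewrite !inE eqxx !orbT. Qed.

Let tau_conj : tau = rho *m reflection n2 *m rho.
Proof.
have mr : m = rho *m n2 by rewrite rhoE reflection_unit// n12 mE mulrN scaleNr opprK.
have rl : lorentz rho by rewrite rhoE; exact: reflection_lorentz.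
by rewrite tauE mr -reflection_conj// -mulmxA rhoK mulmx1.
Qed.

Let W_tau : W tau.
Proof.
rewrite tau_conj; apply: WM => //; apply: WM => //.
by apply: W_refl; rewrite !inE eqxx orbT.
Qed.

Let W_gz (j : int) : W (g ^ j).
Proof.
have gW : (generated [set g] `<=` W)%classic; last exact: gW (expz_generated (g := g) j).
apply: generated_min; first exact: generated_subgroup.
by move=> _ ->; rewrite gE; exact: WM.
Qed.

Let W_D h : D h -> W h.
Proof. by move=> [j [->|->]] //; exact: WM. Qed.

(* [F p q] is the combination [p *: f1 + q *: f2] of the feet
   [f1 = - (m + k *: n3)] and [f2 = - (n3 + k *: m)] of the common perpendicular
   of the geodesics [n3] and [m]. *)
Let F p q := - ((p + k * q) *: m + (p * k + q) *: n3).

Let F_pt p q : F p q = pt ((p + q * nu) / 2) ((p + q * mu) / 2).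
Proof.
rewrite ptDE /F; congr (- (_ *: _ + _ *: _)).
  by rewrite muE nuE; field.
have -> : (p + q * nu) / 2 * mu + (p + q * mu) / 2 * nu =
  p * ((mu + nu) / 2) + q * (mu * nu) by field.
by rewrite munu muE nuE; field.
Qed.

Let mdot_n1F p q : mdot n1 (F p q) = p * (k * y - z) - q * (k * z - y).
Proof. by rewrite /F !mdot_lin n1m n13; ring. Qed.
Let mdot_n3F p q : mdot n3 (F p q) = q * e ^+ 2.
Proof. by rewrite /F !mdot_lin (mdotC n3 m) mn3 n33 ee; ring. Qed.
Let mdot_mF p q : mdot m (F p q) = p * e ^+ 2.
Proof. by rewrite /F !mdot_lin mn3 mm ee; ring. Qed.
Let mdot_n2F p q : mdot n2 (F p q) = p * e ^+ 2 - 2 * z * mdot n1 (F p q).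
Proof. by rewrite -(mdot_mF p q) mE mdotDl mdotZl; ring. Qed.

(** The cone over the segment between the two feet, half a period of the axis, kept homogeneous to
    avoid normalizing points. *)
Let cone X := exists p q, [/\ 0 <= p, 0 <= q, 0 < p + q & X = F p q].

Let pt_cone a b : 0 < a -> a <= b -> b <= lam * a -> cone (pt a b).
Proof.
move=> a0 ab bla; have b0 : 0 < b by exact: lt_le_trans ab.
(* Solves [F p q = pt a b] through [F_pt], with [mu - nu = 2 * e]. *)
exists ((mu * a - nu * b) / e), ((b - a) / e).
have en : e != 0 by rewrite gt_eqF.
have nb : nu * b <= mu * a.
  have -> : mu * a = nu * (lam * a).
    have -> : nu * (lam * a) = mu * nu * (mu * a) by rewrite lamE; ring.
    by rewrite munu mul1r.
  by rewrite ler_pM2l.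
split.
- by rewrite divr_ge0 ?subr_ge0// ltW.
- by rewrite divr_ge0 ?subr_ge0// ltW.
- rewrite -mulrDl divr_gt0//.
  have : 0 < (mu - 1) * a by rewrite mulr_gt0// subr_gt0.
  have : 0 < (1 - nu) * b by rewrite mulr_gt0// subr_gt0.
  lra.
- have mn : mu - nu = 2 * e by rewrite muE nuE; ring.
  rewrite F_pt; congr (_ *: _ + _ *: _).
    have -> : (mu * a - nu * b) / e + (b - a) / e * nu = (mu - nu) * a / e by field.
    by rewrite mn; field.
  have -> : (mu * a - nu * b) / e + (b - a) / e * mu = (mu - nu) * b / e by field.
  by rewrite mn; field.
Qed.

(** [g] divides the ratio [b / a] by [lam ^+ 2] and [sig] inverts it, so together they bring it
    between 1 and [lam], which is the cone. *)
Let D_cone a b : 0 < a -> 0 < b -> exists2 d, D d & cone (d *m pt a b).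
Proof.
move=> a0 b0; wlog ab : a b a0 b0 / a <= b => [H|].
  have [/H|/ltW ba] := leP a b; first exact.
  have [d Dd] := H b a b0 a0 ba; rewrite -sig_pt mulmxA.
  by exists (d *m sig) => //; exact: DM.
have [n bn] : exists n : nat, b <= lam ^+ n * a.
  (* Bernoulli's inequality, which provides a power of [lam] above [b / a]. *)
  have bern (n : nat) : 1 + n%:R * (lam - 1) <= lam ^+ n.
    elim: n => [|n IH]; first by rewrite mul0r addr0 expr0.
    rewrite exprS; apply: le_trans (_ : lam * (1 + n%:R * (lam - 1)) <= _); last by rewrite ler_pM2l.
    have : 0 <= n%:R * (lam - 1) ^+ 2 by rewrite mulr_ge0// sqr_ge0.
    by rewrite -(addn1 n) natrD; lra.
  have l0 : 0 < lam - 1 by rewrite subr_gt0.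
  pose t := b / a / (lam - 1); exists (Num.bound t).
  rewrite -ler_pdivrMr//; apply: le_trans (bern _).
  have : t <= (Num.bound t)%:R.
    by apply: ltW; apply: archi_boundP; rewrite !divr_ge0// ltW.
  by rewrite /t ler_pdivrMr//; lra.
elim: n a b a0 b0 ab bn => [|n IH] a b a0 b0 ab bn.
  exists 1%:M => //; rewrite mul1mx; apply: pt_cone => //.
  by rewrite mul1r in bn; apply: le_trans bn _; rewrite ler_pMl// ltW.
have [bla|lab] := leP b (lam * a).
  by exists 1%:M => //; rewrite mul1mx; exact: pt_cone.
have la0 : 0 < lam * a by exact: mulr_gt0.
have lb0 : 0 < lam^-1 * b by rewrite mulr_gt0// invr_gt0.
have [h|h] := leP (lam * a) (lam^-1 * b).
  have [] := IH _ _ la0 lb0 h.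
    rewrite ler_pdivrMl//; apply: le_trans bn _.
    rewrite exprS -!mulrA ler_pM2l// ler_pM2l//; last by rewrite exprn_gt0.
    by rewrite ler_pMl// ltW.
  move=> d Dd; rewrite -g_pt mulmxA => C; exists (d *m g) => //.
  by apply: DM => //; exact: D_g.
(* After [g] the ratio lies between [lam^-1] and 1, so inverting it suffices. *)
exists (sig *m g); first by apply: DM => //; exact: D_g.
rewrite -mulmxA g_pt sig_pt; apply: pt_cone => //; first exact: ltW.
by rewrite mulVKf ?gt_eqF// ltW.
Qed.

Let unitS : {in S, forall s, mdot s s = 1}.
Proof. by move=> s; rewrite !inE => /or3P[]/eqP->. Qed.

Let dihedralS : {in S &, forall s t, s != t -> dihedral_pair s t}.
Proof.
move=> s t; rewrite !inE => /or3P[]/eqP-> /or3P[]/eqP->; rewrite ?eqxx// => _;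
  by [|exact: dihedral_pairC].
Qed.

Let rho_mdot s X : mdot s (rho *m X) = mdot s X - 2 * mdot n1 X * mdot s n1.
Proof. by rewrite rhoE reflection_unit// !mdot_lin. Qed.

(* The fundamental segment of the axis crosses the side [n1]; reflecting its far
   part back folds it into the chamber. *)
Let cone_fold X : cone X -> exists f,
  [/\ f = 1%:M /\ 0 <= mdot n1 X \/ f = rho /\ mdot n1 X < 0,
      chamber S (f *m X),
      {in S &, forall s t, mdot s (f *m X) = 0 -> mdot t (f *m X) = 0 -> s = t}
    & forall s, s \in S -> mdot s (f *m X) = 0 ->
      [/\ f = 1%:M, s = n1 & mdot n1 X = 0] \/ D (f *m reflection s *m f)].
Proof.
move=> [p [q [p0 q0 pq XE]]];
have e2 : 0 < e ^+ 2 by rewrite exprn_gt0.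
have A0 : 0 < k * y - z by rewrite subr_gt0.
have C0 : 0 < k * z - y by rewrite subr_gt0.
have n1X : mdot n1 X = p * (k * y - z) - q * (k * z - y) by rewrite XE mdot_n1F.
have n3X : mdot n3 X = q * e ^+ 2 by rewrite XE mdot_n3F.
have n2X : mdot n2 X = p * e ^+ 2 - 2 * z * mdot n1 X by rewrite XE mdot_n2F.
have kk : k ^+ 2 = k * x + 2 * k * y * z by rewrite expr2 {2}kE; ring.
have [h|h] := leP 0 (mdot n1 X).
- have p_gt0 : 0 < p.
    rewrite lt_neqAle p0 andbT eq_sym; apply/eqP => pe.
    have : 0 < q * (k * z - y) by rewrite mulr_gt0//; move: pq; rewrite pe add0r.
    by move: h; rewrite n1X pe; lra.
  (* At the foot on ab, where [q = 0], this is exactly [kxz]. *)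
  have n2X_gt0 : 0 < mdot n2 X.
    have -> : mdot n2 X = p * (k * x + 2 * z ^+ 2 - 1) + 2 * z * (q * (k * z - y)).
      by rewrite n2X n1X ee kk; ring.
    apply: ltr_wpDr; first by rewrite !mulr_ge0// ltW.
    by rewrite mulr_gt0// subr_gt0.
  have n3X_ge0 : 0 <= mdot n3 X by rewrite n3X mulr_ge0// ltW.
  have n13X : mdot n1 X = 0 -> mdot n3 X = 0 -> False.
    rewrite n1X => h1 /eqP; rewrite n3X mulf_eq0 (gt_eqF e2) orbF => /eqP q_eq0.
    have : 0 < p * (k * y - z) by rewrite mulr_gt0.
    by move: h1; rewrite q_eq0; lra.
  exists 1%:M; rewrite mul1mx; split; first by left.
  + by move=> s; rewrite !inE => /or3P[]/eqP-> //; exact: ltW.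
  + move=> s t; rewrite !inE => /or3P[]/eqP-> /or3P[]/eqP-> // h1 h2; exfalso;
      by [exact: n13X|move: n2X_gt0; rewrite ?h1 ?h2 ltxx].
  + move=> s; rewrite !inE => /or3P[]/eqP-> h1; first by left.
      by move: n2X_gt0; rewrite h1 ltxx.
    by right; rewrite mul1mx mulmx1 -sigE; exact: Dsig.
- have q_gt0 : 0 < q.
    rewrite lt_neqAle q0 andbT eq_sym; apply/eqP => qe.
    have : 0 <= p * (k * y - z) by rewrite mulr_ge0// ltW.
    by move: h; rewrite n1X qe; lra.
  have r1 : mdot n1 (rho *m X) = - mdot n1 X by rewrite rho_mdot n11; ring.
  have r2 : mdot n2 (rho *m X) = p * e ^+ 2.
    by rewrite rho_mdot (mdotC n2 n1) n12 n2X; ring.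
  (* At the folded far foot, where [p = 0], this is exactly [kxy]. *)
  have r3 : 0 < mdot n3 (rho *m X).
    have -> : mdot n3 (rho *m X) =
        q * (k * x + 2 * y ^+ 2 - 1) + 2 * y * (p * (k * y - z)).
      by rewrite rho_mdot (mdotC n3 n1) n13 n3X n1X ee kk; ring.
    apply: ltr_wpDr; first by rewrite !mulr_ge0// ltW.
    by rewrite mulr_gt0// subr_gt0.
  have r1_gt0 : 0 < mdot n1 (rho *m X) by rewrite r1 oppr_gt0.
  exists rho; split; first by right.
  + move=> s; rewrite !inE => /or3P[]/eqP->; [exact: ltW| |exact: ltW].
    by rewrite r2 mulr_ge0// ltW.
  + move=> s t; rewrite !inE => /or3P[]/eqP-> /or3P[]/eqP-> // h1 h2; exfalso;
      by [move: r1_gt0; rewrite ?h1 ?h2 ltxx|move: r3; rewrite ?h1 ?h2 ltxx].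
  + move=> s; rewrite !inE => /or3P[]/eqP-> h1.
    * by move: r1_gt0; rewrite h1 ltxx.
    (* Unfolding turns the wall ca into [m], so its reflection becomes [tau]. *)
    * by right; rewrite -tau_conj; exact: Dtau.
    * by move: r3; rewrite h1 ltxx.
Qed.

(** * Returns of the axis to itself *)

Let plane X := exists a b, X = pt a b.

Let plane_F p q : plane (F p q).
Proof. by rewrite F_pt; eexists; eexists. Qed.

(** The plane is spanned by [m] and [n3] and does not contain [n1]: the axis is not perpendicular to
    bc. *)
Let n1_plane c X Y : plane X -> plane Y -> X - Y = c *: n1 -> c = 0.
Proof.
move=> [a [b ->]] [a' [b' ->]] E.
have : (c + 2 * z * (a + b - a' - b')) *: n1 + (a + b - a' - b') *: n2
       + (a * mu + b * nu - a' * mu - b' * nu) *: n3 = 0.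
  rewrite 2!scalerDl -E !ptDE mE; apply/matrixP => i j; rewrite !mxE; ring.
by move=> /n123_free[+ ab _]; rewrite ab mulr0 addr0.
Qed.

Let rho_plane X : plane X -> plane (rho *m X) -> mdot n1 X = 0.
Proof.
move=> pX; rewrite rhoE reflection_unit// => prX.
have /(n1_plane pX prX) : X - (X - (2 * mdot n1 X) *: n1) = (2 * mdot n1 X) *: n1.
  by rewrite subKr.
lra.
Qed.

Let cone_plane X : cone X -> plane X.
Proof. by move=> [p [q [_ _ _ ->]]]; exact: plane_F. Qed.

Let crossing X := cone X /\ mdot n1 X = 0.

(** Conjugating [h] by the folds gives an element between two points of the chamber, hence the
    identity or a wall reflection. The walls ab and ca are met only at the feet and unfold into [D];
    the wall bc is met only at the crossing. *)
Let cone_return X Y h : cone X -> cone Y -> W h -> h *m X = Y ->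
  D h \/ [/\ X = Y, crossing X & h = rho].
Proof.
move=> cX cY Wh hXY.
have [f [fX fC fU fS]] := cone_fold cX; have [f' [fY fC' _ _]] := cone_fold cY.
have ff : f *m f = 1%:M by case: fX => -[-> _]; rewrite ?mul1mx.
have ff' : f' *m f' = 1%:M by case: fY => -[-> _]; rewrite ?mul1mx.
have W1 : W 1%:M by have [] := generated_subgroup [set reflection s | s in [set` S]]%classic.
have Wf : W f by case: fX => -[-> _].
have Wf' : W f' by case: fY => -[-> _].
have Wk : W (f' *m h *m f) by apply: WM => //; exact: WM.
have kX : (f' *m h *m f) *m (f *m X) = f' *m Y.
  by rewrite -!mulmxA (mulmxA f f) ff mul1mx hXY.
have kC : chamber S ((f' *m h *m f) *m (f *m X)) by rewrite kX.
have cf := chamber_fundamental unitS dihedralS Wk fC kC fU.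
have fXY : f' *m Y = f *m X.
  rewrite -kX; case: cf => [->|[s [sS s0 ->]]]; first by rewrite mul1mx.
  by rewrite reflection_fix ?unitS.
have [fE XY] : f' = f /\ X = Y.
  have ff_eq : f' = f -> X = Y.
    by move=> E; rewrite -[X]mul1mx -[Y]mul1mx -ff -!mulmxA -fXY E.
  (* If only one point is folded, [rho] maps it into the plane of the axis again, which by
     [rho_plane] puts it on bc; but only points strictly beyond bc are folded. *)
  case: fX fY => -[fE nX] [] [fE' nY]; try by rewrite fE' fE in ff_eq *; split=> //; exact: ff_eq.
  - exfalso; have : plane (rho *m Y).
      by rewrite -fE' fXY fE mul1mx; exact: cone_plane.
    by move/(rho_plane (cone_plane cY)); lra.
  - exfalso; have : plane (rho *m X).
      by rewrite -fE -fXY fE' mul1mx; exact: cone_plane.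
    by move/(rho_plane (cone_plane cX)); lra.
have hE : h = f *m (f' *m h *m f) *m f.
  by rewrite -!mulmxA ff mulmx1 fE mulmxA ff mul1mx.
case: cf => [k1'|[s [sS s0 ks]]].
  by left; rewrite hE k1' mulmx1 ff.
rewrite ks in hE; have [[f1 sn1 nX]|Ds] := fS s sS s0.
  right; split=> //; by rewrite hE f1 mul1mx mulmx1 sn1.
by left; rewrite hE.
Qed.

Let axis_return a b a' b' h : 0 < a -> 0 < b -> 0 < a' -> 0 < b' ->
  W h -> h *m pt a b = pt a' b' ->
  D h \/ exists d d' X, [/\ D d, D d', crossing X,
    X = d *m pt a b /\ X = d' *m pt a' b' & d' *m h = rho *m d].
Proof.
move=> a0 b0 a0' b0' Wh hE.
have [d Dd cX] := D_cone a0 b0; have [d' Dd' cY] := D_cone a0' b0'.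
have [di Ddi [di1 di2]] := DV Dd; have [di' Ddi' [di1' di2']] := DV Dd'.
have Wk : W (d' *m h *m di) by apply: WM; [apply: WM|] => //; exact: W_D.
have kE' : (d' *m h *m di) *m (d *m pt a b) = d' *m pt a' b'.
  by rewrite -!mulmxA (mulmxA di) di1 mul1mx hE.
have [Dk|[XY cr kr]] := cone_return cX cY Wk kE'.
  left; have -> : h = di' *m (d' *m h *m di) *m d.
    by rewrite -!mulmxA di1 mulmx1 mulmxA di1' mul1mx.
  by apply: DM => //; exact: DM.
right; exists d, d', (d *m pt a b); split=> //.
by rewrite -kr -(mulmxA _ di) di1 mulmx1.
Qed.

(** * Endpoints and points of the axis *)

Let W_word h : W h -> exists2 w, word S w & h = act w.
Proof. exact: reflection_group_word. Qed.

Let W_lorentz h : W h -> lorentz h.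
Proof. by move=> /W_word[w wS ->]; exact: act_lorentz wS. Qed.

Let W_hplane h X : W h -> hplane X -> hplane (h *m X).
Proof.
move=> /W_word[w + ->] hX; elim: w => [_|s w IH /= /andP[sS wS]].
  by rewrite mul1mx.
by rewrite -mulmxA; apply: reflection_hplane; [exact: unitS|exact: IH].
Qed.

Let W_unit h : W h -> h \in unitmx.
Proof.
by move=> /W_word[w wS ->]; rewrite unitmxE (det_act unitS)// unitrX// unitrN1.
Qed.

Let mdot_pt a b : mdot (pt a b) (pt a b) = 2 * (a * b) * mdot u v.
Proof. by rewrite !mdot_lin uu vv (mdotC v u); ring. Qed.

(** [u] and [v] lie on one sheet, and half their sum is the foot [F 1 0], a point of the chamber,
    which decides for the future. *)
Let ideal_uv : ideal u /\ ideal v.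
Proof.
have u0v0 : 0 < u 0 0 * v 0 0 by apply: same_sheet; rewrite ?uu ?vv.
have F10 : cone (F 1 0) by exists 1, 0; rewrite ler01 lexx addr0 ltr01.
have nF : 0 <= mdot n1 (F 1 0) by rewrite mdot_n1F mul1r mul0r subr0 subr_ge0 ltW.
have : 0 <= (F 1 0) 0 0.
  have [f [[[-> _]|[_ ]]]] := cone_fold F10; last by rewrite ltNge nF.
  by rewrite mul1mx => /chamber_future.
rewrite F_pt mul0r mul0r addr0 !mxE => sum.
have [u0|u0] := ltP 0 (u 0 0).
  by split; split=> //; rewrite -(pmulr_rgt0 _ u0).
have u_lt0 : u 0 0 < 0 by rewrite lt_neqAle u0 andbT; apply: contraTneq u0v0 => ->; rewrite mul0r ltxx.
have : v 0 0 < 0 by rewrite -(nmulr_rgt0 _ u_lt0).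
by move: sum u_lt0; lra.
Qed.

Let hplane_pt a b : hplane (pt a b) -> 0 < a /\ 0 < b.
Proof.
have [[_ u0] [_ v0]] := ideal_uv.
move=> []; rewrite mdot_pt !mxE => ab sum.
have ab0 : 0 < a * b by move: uv_lt0 ab; set t := mdot u v; nra.
have [a0|a0] := ltP 0 a; first by rewrite -(pmulr_rgt0 b a0).
have b0 : b <= 0 by rewrite leNgt; apply/negP => b0; move: ab0; rewrite ltNge mulr_le0_ge0// ltW.
have : a * u 0 0 <= 0 by rewrite mulr_le0_ge0// ltW.
have : b * v 0 0 <= 0 by rewrite mulr_le0_ge0// ltW.
by move: sum; lra.
Qed.

Let pt_hplane a b : 0 < a -> 0 < b -> exists2 c, 0 < c & hplane (c *: pt a b).
Proof.
have [[_ u0] [_ v0]] := ideal_uv; move=> a0 b0.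
have n0 : 0 < - mdot (pt a b) (pt a b).
  by rewrite mdot_pt oppr_gt0 nmulr_llt0 ?uv_lt0// !mulr_gt0.
have c0 : 0 < (Num.sqrt (- mdot (pt a b) (pt a b)))^-1 by rewrite invr_gt0 sqrtr_gt0.
exists (Num.sqrt (- mdot (pt a b) (pt a b)))^-1 => //; split.
  rewrite mdotZl mdotZr mulrA -expr2 exprVn sqr_sqrtr; last exact: ltW.
  by rewrite invrN mulNr mulVf// -oppr_eq0 gt_eqF.
by rewrite mxE mulr_gt0// !mxE addr_gt0// mulr_gt0.
Qed.

Let g_u : g *m u = lam *: u.
Proof. by have := g_pt 1 0; rewrite scale1r scale0r addr0 !mulr0 mulr1 scale0r addr0. Qed.
Let g_v : g *m v = lam^-1 *: v.
Proof. by have := g_pt 0 1; rewrite scale1r scale0r add0r !mulr0 mulr1 scale0r add0r. Qed.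

Let W_g : W g. Proof. by rewrite gE; exact: WM. Qed.

(** A fixed direction [w] with factor [c] satisfies [c * lam = 1] unless orthogonal to [u], and
    [c = lam] unless orthogonal to [v]. Both cannot hold, and orthogonal ideal points coincide. *)
Let fixes_uv : fixes_exactly g u v.
Proof.
have [iu iv] := ideal_uv; have [_ u0] := iu; have [_ v0] := iv.
split=> // [[c _ vE']|w].
  by move: uv_lt0; rewrite vE' mdotZr uu mulr0 ltxx.
split=> [[iw [c c0 gw]]|].
  have wu : c * lam * mdot w u = mdot w u.
    by rewrite -[RHS](W_lorentz W_g) gw g_u mdotZl mdotZr; ring.
  have wv : c * lam^-1 * mdot w v = mdot w v.
    by rewrite -[RHS](W_lorentz W_g) gw g_v mdotZl mdotZr; ring.
  have [wu0|wu0] := eqVneq (mdot w u) 0.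
    by left; apply: ideal_orthogonal => //; rewrite mdotC.
  have [wv0|wv0] := eqVneq (mdot w v) 0.
    by right; apply: ideal_orthogonal => //; rewrite mdotC.
  exfalso; have c1 : c * lam = 1 by apply: (mulIf wu0); rewrite mul1r.
  have c2 : c * lam^-1 = 1 by apply: (mulIf wv0); rewrite mul1r.
  have c_lam : c = lam by rewrite -[c]mulr1 -(mulVf (lt0r_neq0 lam0)) mulrA c2 mul1r.
  have : 1 < lam * lam by have := lam1; nra.
  by rewrite -{1}c_lam c1 ltxx.
have scale_ideal c t : 0 < c -> ideal t -> ideal (c *: t).
  by move=> c0 [tt t0]; split; rewrite ?mdotZl ?mdotZr ?tt ?mulr0// mxE mulr_gt0.
move=> [[c c0 ->]|[c c0 ->]]; split; try exact: scale_ideal.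
  by exists lam => //; rewrite -scalemxAr g_u !scalerA mulrC.
by exists lam^-1; rewrite ?invr_gt0// -scalemxAr g_v !scalerA mulrC.
Qed.

Let ax X := hplane X /\ exists a b, [/\ 0 < a, 0 < b & X = pt a b].

Let axisE X : axis g X <-> ax X.
Proof.
split=> [[hX [u' [v' [[iu' iv' _ fix_uv] [s [t XE]]]]]]|[hX [a [b [a0 b0 XE]]]]]; last first.
  by split=> //; exists u, v; split; [exact: fixes_uv|exists a, b].
have [_ _ _ fix_uv'] := fixes_uv.
have same_refl w : same_ideal w w by exists 1 => //; rewrite scale1r.
have pl w : fixes_ideal g w -> plane w.
  move=> /fix_uv'[[c _ ->]|[c _ ->]]; [exists c, 0|exists 0, c];
    by rewrite scale0r ?addr0 ?add0r.
have [a [b u'E]] : plane u' by apply/pl/fix_uv; left.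
have [a' [b' v'E]] : plane v' by apply/pl/fix_uv; right.
split=> //; exists (s * a + t * a'), (s * b + t * b').
have XE' : X = pt (s * a + t * a') (s * b + t * b').
  by rewrite XE u'E v'E; apply/matrixP => i j; rewrite !mxE; ring.
by move: hX; rewrite XE' => /hplane_pt[].
Qed.

Let D_ax d X : D d -> ax X -> ax (d *m X).
Proof.
move=> Dd [hX [a [b [a0 b0 XE]]]]; split; first exact: W_hplane (W_D Dd) hX.
by rewrite XE; have [a' [b' [a0' b0' ->]]] := D_pt Dd a0 b0; exists a', b'.
Qed.

Let ax_return X Y h : ax X -> ax Y -> W h -> h *m X = Y ->
  D h \/ exists d d' Z, [/\ D d, D d', crossing Z /\ ax Z,
    Z = d *m X /\ Z = d' *m Y & d' *m h = rho *m d].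
Proof.
move=> aX aY Wh hXY.
have [_ [a [b [a0 b0 XE]]]] := aX; have [_ [a' [b' [a0' b0' YE]]]] := aY.
rewrite XE YE in hXY.
have [Dh|[d [d' [Z [Dd Dd' cZ ZE dh]]]]] := axis_return a0 b0 a0' b0' Wh hXY.
  by left.
right; exists d, d', Z; rewrite XE YE; split=> //; split=> //.
by rewrite ZE.1 -XE; exact: D_ax.
Qed.

(** * The crossing with the side bc *)

Let crossingP Z : crossing Z -> exists p q,
  [/\ 0 < p, 0 < q, p * (k * y - z) = q * (k * z - y) & Z = F p q].
Proof.
move=> [[p [q [p0 q0 pq ZE]]] n1Z]; exists p, q.
have A0 : 0 < k * y - z by rewrite subr_gt0.
have C0 : 0 < k * z - y by rewrite subr_gt0.
have E : p * (k * y - z) = q * (k * z - y).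
  by apply/eqP; rewrite -subr_eq0 -mdot_n1F -ZE n1Z.
have pq0 : (p == 0) = (q == 0).
  have := congr1 (fun t => t == 0) E.
  by rewrite !mulf_eq0 (gt_eqF A0) (gt_eqF C0) !orbF.
have p_gt0 : 0 < p.
  rewrite lt_neqAle p0 eq_sym andbT; apply/negP => pe.
  have /eqP q_eq0 : q == 0 by rewrite -pq0.
  by move: pq; rewrite (eqP pe) q_eq0 addr0 ltxx.
by split=> //; rewrite lt_neqAle q0 eq_sym andbT -pq0 gt_eqF.
Qed.

Let F_scale c p q : F (c * p) (c * q) = c *: F p q.
Proof. by apply/matrixP => i j; rewrite !mxE; ring. Qed.

Let crossing_exists : exists2 Z, crossing Z & ax Z.
Proof.
have A0 : 0 < k * y - z by rewrite subr_gt0.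
have C0 : 0 < k * z - y by rewrite subr_gt0.
pose a := (k * z - y + (k * y - z) * nu) / 2.
pose b := (k * z - y + (k * y - z) * mu) / 2.
have a0 : 0 < a by rewrite divr_gt0// addr_gt0// mulr_gt0.
have b0 : 0 < b by rewrite divr_gt0// addr_gt0// mulr_gt0// (lt_trans _ mu1).
have [c c0 hc] := pt_hplane a0 b0.
have ZE : c *: pt a b = F (c * (k * z - y)) (c * (k * y - z)).
  by rewrite F_scale F_pt.
exists (c *: pt a b).
  split; last by rewrite ZE mdot_n1F; ring.
  exists (c * (k * z - y)), (c * (k * y - z)); rewrite ZE; split=> //.
  - by rewrite mulr_ge0// ltW.
  - by rewrite mulr_ge0// ltW.
  - by rewrite addr_gt0// mulr_gt0.
split=> //; exists (c * a), (c * b).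
by split; [exact: mulr_gt0|exact: mulr_gt0|rewrite scalerDr !scalerA].
Qed.

Let crossing_uniq Z Z' : crossing Z -> crossing Z' -> hplane Z -> hplane Z' -> Z = Z'.
Proof.
move=> /crossingP[p [q [p0 q0 E ZE]]] /crossingP[p' [q' [p0' q0' E' ZE']]] [ZZ _] [ZZ' _].
have C0 : k * z - y != 0 by rewrite gt_eqF// subr_gt0.
have ZtZ' : Z = (p / p') *: Z'.
  rewrite ZE ZE' -F_scale; congr F; first by rewrite divfK// gt_eqF.
  apply: (mulIf C0); rewrite -mulrA -E' mulrA divfK ?gt_eqF//.
have t0 : 0 < p / p' by rewrite divr_gt0.
move: ZZ; rewrite ZtZ' mdotZl mdotZr ZZ'; set t := p / p' in t0 ZtZ' *.
move=> tt; suff -> : t = 1 by rewrite scale1r.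
by apply/eqP; rewrite -(eqrXn2 (n := 2))// ?ltW// expr1n; apply/eqP; lra.
Qed.

(** A fixed point [pt a b] of [g ^ j *m sig] has [b / a = lam ^ (- j)], while the crossing is
    strictly between the feet and has its ratio strictly between 1 and [lam]. *)
Let crossing_nofix d Z : D d -> \det d < 0 -> crossing Z -> d *m Z <> Z.
Proof.
move=> Dd /(D_neg Dd)[j ->] /crossingP[p [q [p0 q0 _ ->]]].
rewrite F_pt -mulmxA sig_pt gz_pt => /pt_inj[+ _].
set a := (p + q * nu) / 2; set b := (p + q * mu) / 2 => ab.
have b0 : 0 < b by rewrite divr_gt0// addr_gt0// mulr_gt0// (lt_trans _ mu1).
have a_lt_b : a < b.
  by rewrite ltr_pM2r ?invr_gt0// ltrD2l ltr_pM2l// (lt_trans nu1).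
have b_lt_a : b < lam * a.
  rewrite /a /b mulrA ltr_pM2r ?invr_gt0//.
  have -> : lam * (p + q * nu) = lam * p + q * mu * (mu * nu) by rewrite lamE; ring.
  by rewrite munu mulr1 ltrD2r -[ltLHS]mul1r ltr_pM2r.
have j0 : j < 0.
  by rewrite -(ltr_eXz2l lam1) expr0z -(ltr_pM2r b0) ab mul1r.
have j1 : -1 < j.
  rewrite -(ltr_eXz2l lam1) -(ltr_pM2r b0) ab exprN1 mulrC ltr_pdivrMr//.
  by rewrite mulrC.
by move: j1; rewrite -lezD1 addNr leNgt j0.
Qed.

(** Otherwise [rho] would preserve the axis, yet it moves the foot on ab out of the plane of the
    axis. *)
Let no_crossing_stab h d d' : D d -> D d' -> d' *m h = rho *m d ->
  (forall X, ax X -> ax (h *m X)) -> False.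
Proof.
move=> Dd Dd' dh hax.
have half : 0 < (1 : R) / 2 by rewrite divr_gt0.
have [c c0 hc] := pt_hplane half half.
set X := c *: pt (1 / 2) (1 / 2) in hc.
have aX : ax X.
  split=> //; exists (c * (1 / 2)), (c * (1 / 2)).
  by split; [exact: mulr_gt0|exact: mulr_gt0|rewrite /X scalerDr !scalerA].
have [di Ddi [_ di2]] := DV Dd.
have pl Z : ax Z -> plane Z by move=> [_ [a [b [_ _ ->]]]]; exists a, b.
have : ax (rho *m X).
  rewrite -[rho]mulmx1 -di2 mulmxA -dh -!mulmxA.
  by apply/(D_ax Dd')/hax/D_ax.
move=> /pl /(rho_plane (pl _ aX)).
have -> : X = c *: F 1 0 by rewrite F_pt !mul0r addr0.
have : 0 < c * (k * y - z) by rewrite mulr_gt0// subr_gt0.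
by rewrite mdotZr mdot_n1F mul1r mul0r subr0; lra.
Qed.

(** * Orbifold points, primitivity and the double point *)

Let G := [set h | W h /\ 0 < \det h]%classic.
Let Z_g := generated [set g]%classic.

Let G_subgroup : is_subgroup G.
Proof.
have [W1 _ WV] := generated_subgroup [set reflection s | s in [set` S]]%classic.
split; first by split=> //; rewrite det1.
- by move=> h h' [Wh h0] [Wh' h0']; split; [exact: WM|rewrite det_mulmx mulr_gt0].
- by move=> h [Wh h0]; split; [exact: WV|rewrite det_inv invr_gt0].
Qed.

Let G_unit h : G h -> h \in unitmx. Proof. by move=> [/W_unit]. Qed.

Let G_gz (j : int) : G (g ^ j).
Proof. by split; [exact: W_gz|rewrite det_gz]. Qed.

Let Zg_gz (j : int) : Z_g (g ^ j). Proof. exact: expz_generated. Qed.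

Let Zg_D h : D h -> 0 < \det h -> Z_g h.
Proof. by move=> Dh /(D_pos Dh)[j ->]. Qed.

Let Zg_unit h : Z_g h -> h \in unitmx.
Proof. by move=> /(generated_expz g_unit)[j ->]; exact: unitrXz. Qed.

Let ZgP := projP (generated_subgroup [set g]%classic) Zg_unit.
Let GP := projP G_subgroup G_unit.

Let det_rho : \det rho = -1. Proof. by rewrite rhoE det_reflection. Qed.

(** A stabilizing element in [D] is a power of [g], hence trivial. One outside [D] carries the
    factor [rho], so comparing the two routes from [X] to the crossing gives an
    orientation-reversing element of [D] fixing the crossing. *)
Let orbifold_free X : ax X -> ~ orbifold_point G (proj G X).
Proof.
move=> aX [Y [_ [h Gh [h1 hY]]]] /GP[h' Gh' h'Y].
have [_ GM GV] := G_subgroup.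
pose f := h' *m h *m invmx h'.
have Gf : G f by exact: (GM _ _ (GM _ _ Gh' Gh) (GV _ Gh')).
have fX : f *m X = X.
  by rewrite -h'Y -!mulmxA (mulmxA (invmx h')) mulVmx ?G_unit// mul1mx hY.
have f1 : f <> 1%:M.
  move=> fE; apply: h1.
  have : invmx h' *m f *m h' = h.
    by rewrite /f !mulmxA mulVmx ?G_unit// mul1mx -mulmxA mulVmx ?G_unit// mulmx1.
  by rewrite fE mulmx1 mulVmx ?G_unit.
clearbody f; have [Wf f0] := Gf.
have [Df|[d [d' [Z [Dd Dd' [cZ _] [Zd Zd'] dfE]]]]] := ax_return aX aX Wf fX.
  have [j fj] := D_pos Df f0; have [_ [a [b [a0 b0 XE]]]] := aX.
  move: fX; rewrite fj XE gz_pt => /pt_inj[+ _].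
  rewrite -[RHS]mul1r => /(mulIf (lt0r_neq0 a0)) /eqP.
  rewrite pexprz_eq1 ?(ltW lam0)// (gt_eqF lam1) orbF => /eqP j0.
  by apply: f1; rewrite fj j0 expr0z.
have [di Ddi [di1 _]] := DV Dd.
apply: (crossing_nofix (d := d' *m di) _ _ cZ); first exact: DM.
  have := congr1 determinant dfE; rewrite !det_mulmx det_rho => dd.
  have d0 : \det di * \det d = 1 by rewrite -det_mulmx di1 det1.
  have -> : \det d' * \det di = - (\det f)^-1.
    apply: (mulIf (lt0r_neq0 f0)); rewrite mulNr mulVf ?gt_eqF//.
    by rewrite mulrAC dd -mulrA (mulrC (\det d)) d0; ring.
  by rewrite oppr_lt0 invr_gt0.
by rewrite {1}Zd -mulmxA (mulmxA di) di1 mul1mx -Zd'.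
Qed.

(** A root [h] commutes with [g], so it preserves the axis and lies in [D]; it is then a power of
    [g], and comparing exponents of [lam] forces the exponent of the root to be 1. *)
Let g_primitive : primitive G g.
Proof.
move=> [h [Wh h0] [l l1 gh]].
have comm : g *m h = h *m g by rewrite !mulmxE gh -exprSr -exprS.
have [iu iv] := ideal_uv.
have hax X : ax X -> ax (h *m X).
  move=> aX; have hX := W_hplane Wh aX.1.
  have [_ [a [b [a0 b0 XE]]]] := aX.
  have hl := W_lorentz Wh; have gl := W_lorentz W_g.
  (* Applying [g] to both arguments multiplies this product by [lam * lam]. *)
  have hu0 : mdot u (h *m u) = 0.
    have : mdot u (h *m u) = lam * lam * mdot u (h *m u).
      by rewrite -{1}gl mulmxA comm -mulmxA g_u -scalemxAr mdotZl mdotZr mulrA.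
    have : lam * lam != 1 by rewrite gt_eqF//; have := lam1; nra.
    by move=> ll /eqP; rewrite -subr_eq0 -{1}[mdot _ _]mul1r -mulrBl mulf_eq0 subr_eq0
      eq_sym (negbTE ll) => /eqP.
  have hv0 : mdot v (h *m v) = 0.
    have : mdot v (h *m v) = lam^-1 * lam^-1 * mdot v (h *m v).
      by rewrite -{1}gl mulmxA comm -mulmxA g_v -scalemxAr mdotZl mdotZr mulrA.
    have : lam^-1 * lam^-1 != 1.
      by rewrite lt_eqF// -invfM invf_lt1 ?mulr_gt0//; have := lam1; nra.
    by move=> ll /eqP; rewrite -subr_eq0 -{1}[mdot _ _]mul1r -mulrBl mulf_eq0 subr_eq0
      eq_sym (negbTE ll) => /eqP.
  have hX0 : 0 < a * (h *m u) 0 0 + b * (h *m v) 0 0.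
    by move: hX => [_]; rewrite XE mulmxDr -!scalemxAr mxE mxE [X in _ + X]mxE.
  have huv : 0 < (h *m u) 0 0 * (h *m v) 0 0.
    by apply: same_sheet; rewrite hl ?uu ?vv ?uv_lt0.
  have [iu' iv'] : ideal (h *m u) /\ ideal (h *m v).
    have pos : 0 < (h *m u) 0 0 /\ 0 < (h *m v) 0 0.
      move: hX0 huv; set s := (h *m u) 0 0; set t := (h *m v) 0 0 => st st0.
      have [s0|s0] := ltP 0 s; first by split=> //; rewrite -(pmulr_rgt0 _ s0).
      exfalso; have t0 : t <= 0.
        by rewrite leNgt; apply/negP => t0; move: st0; rewrite ltNge mulr_le0_ge0// ltW.
      have : a * s <= 0 by rewrite mulr_ge0_le0// ltW.
      have : b * t <= 0 by rewrite mulr_ge0_le0// ltW.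
      by move: st; lra.
    by split; split; rewrite ?hl ?uu ?vv//; case: pos.
  have [c c0 huE] := ideal_orthogonal iu iu' hu0.
  have [c' c0' hvE] := ideal_orthogonal iv iv' hv0.
  split=> //; exists (a * c), (b * c'); split; rewrite ?mulr_gt0//.
  by rewrite XE mulmxDr -!scalemxAr huE hvE !scalerA.
have [Z _ aZ] := crossing_exists.
have [Dh|[d [d' [_ [Dd Dd' _ _ dh]]]]] := ax_return aZ (hax _ aZ) Wh erefl; last first.
  exact: no_crossing_stab Dd Dd' dh hax.
have [j hj] := D_pos Dh h0.
have [_ [a [b [a0 b0 ZE]]]] := aZ.
have : g *m pt a b = g ^ (j * l%:Z) *m pt a b by rewrite -exprz_exp -hj {1}gh.
rewrite g_pt gz_pt => /pt_inj[/(mulIf (lt0r_neq0 a0)) + _].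
rewrite -{1}[lam]expr1z => /(ieexprIz lam0).
rewrite gt_eqF// => /(_ isT) /(congr1 absz); rewrite abszM => /esym/eqP.
by rewrite muln_eq1 => /andP[_ /eqP ll]; rewrite /= in ll; rewrite ll in l1.
Qed.

Lemma figure_eight_reflections : figure_eight G g.
Proof.
have [Z cZ aZ] := crossing_exists.
have same_branch X Y h : D h -> G h -> h *m X = Y -> proj Z_g X = proj Z_g Y.
  by move=> Dh [_ h0] hXY; apply/ZgP; exists h => //; exact: Zg_D.
have D_branch d X : D d -> Z = d *m X ->
    proj Z_g X = proj Z_g Z \/ proj Z_g X = proj Z_g (sig *m Z).
  move=> [j [->|->]] ZE.
    by left; apply/ZgP; exists (g ^ j); [exact: Zg_gz|].
  right; apply/ZgP; exists (g ^ (- j)); first exact: Zg_gz.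
  by rewrite ZE mulmxA mulmxA sig_gz -(mulmxA _ sig sig) sigK mulmx1.
have rhoZ : rho *m Z = Z by rewrite rhoE reflection_fix// cZ.2.
(* If [d] reverses orientation, composing with [rho], which fixes [Z], restores it. *)
have crossing_proj d X : D d -> Z = d *m X -> proj G X = proj G Z.
  move=> [j [->|->]] ZE; apply/GP.
    by exists (g ^ j); [exact: G_gz|].
  exists (rho *m (g ^ j *m sig)); last by rewrite -mulmxA -ZE.
  split; first by apply: WM => //; exact: WM.
  by rewrite !det_mulmx det_rho det_gz det_sig; lra.
have eqZ Z' : crossing Z' /\ ax Z' -> Z' = Z.
  by move=> [cZ' [hZ' _]]; apply: crossing_uniq => //; case: aZ.
have asZ : ax (sig *m Z) by exact: D_ax.
have sZ : proj G (sig *m Z) = proj G Z.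
  by apply: (crossing_proj sig) => //; rewrite mulmxA sigK mul1mx.
have two X : ax X -> proj G X = proj G Z ->
    proj Z_g X = proj Z_g Z \/ proj Z_g X = proj Z_g (sig *m Z).
  move=> aX /esym/GP[h Gh hZ].
  have [Dh|[d [d' [Z' [_ Dd' /eqZ ZE [_ Zd'] _]]]]] := ax_return aZ aX Gh.1 hZ.
    by left; apply/esym/(same_branch _ _ h).
  by apply: D_branch Dd' _; rewrite -ZE.
(* A power of [g] joining them, followed by [sig], would fix the crossing and reverse
   orientation. *)
have ne : proj Z_g Z <> proj Z_g (sig *m Z).
  move=> /ZgP[h /(generated_expz g_unit)[j hj] hZ].
  apply: (crossing_nofix (d := sig *m h) _ _ cZ).
  - by apply: DM => //; rewrite hj.
  - by rewrite det_mulmx det_sig hj det_gz; lra.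
  - by rewrite -mulmxA hZ mulmxA sigK mul1mx.
have br X : ax X -> proj G X = proj G Z -> branches G g (proj G Z) (proj Z_g X).
  by move=> aX pX; exists X => //; split=> //; exact/axisE.
split=> //.
- by split; rewrite ?det_g.
- by exists u, v; exact: fixes_uv.
- by move=> X /axisE; exact: orbifold_free.
exists (proj G Z); split.
- apply/seteqP; split=> [Q|_ ->]; last first.
    by exists (proj Z_g Z), (proj Z_g (sig *m Z)); split=> //; exact: br.
  move=> [_ [_ [[X [/axisE aX pX] <-] [Y [/axisE aY pY] <-] XY]]].
  have [h Gh hXY] : exists2 h, G h & h *m X = Y by apply/GP; rewrite pX pY.
  have [Dh|[d [d' [Z' [Dd _ /eqZ ZE [Zd _] _]]]]] := ax_return aX aY Gh.1 hXY.
    by case: XY; exact: same_branch Dh Gh hXY.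
  by rewrite -pX; apply: crossing_proj Dd _; rewrite -ZE.
- exists (proj Z_g Z), (proj Z_g (sig *m Z)); split=> //.
  apply/seteqP; split=> [_ [X [/axisE aX pX] <-]|_ [->|->]]; try exact: br.
  by have [->|->] := two X aX pX; [left|right].
(* Tangential branches mean that [h] preserves the axis; then [h] is in [D] and the branches are
   equal. *)
- move=> X Y h /axisE aX /axisE aY pX Gh YE XY hax.
  have [Dh|[d [d' [_ [Dd Dd' _ _ dh]]]]] := ax_return aX aY Gh.1 (esym YE).
    by apply: XY; exact: same_branch Dh Gh (esym YE).
  apply: no_crossing_stab Dd Dd' dh _ => T aT; apply/axisE; rewrite -hax.
  by exists T => //; exact/axisE.
Qed.

End FigureEight.

(** * The normals of a hyperbolic triangle *)

Section Triangle.
Variable R : realType.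
Implicit Types (x y z w n a b c : 'cV[R]_3) (p q r : \bar int).

(* Minkowski cross product: [mdot (cross x y) z] is the determinant of x, y, z. *)
Definition cross x y : 'cV[R]_3 := \col_i
  (if i == 0 then x ord_max 0 * y 1 0 - x 1 0 * y ord_max 0
   else if i == 1 then x ord_max 0 * y 0 0 - x 0 0 * y ord_max 0
   else x 0 0 * y 1 0 - x 1 0 * y 0 0).

Lemma mdot_crossC x y z : mdot (cross x y) z = mdot (cross y z) x.
Proof. by rewrite !mdotE !mxE /=; ring. Qed.

Lemma mdot_crossl x y : mdot (cross x y) x = 0.
Proof. by rewrite !mdotE !mxE /=; ring. Qed.

Lemma mdot_crossr x y : mdot (cross x y) y = 0.
Proof. by rewrite !mdotE !mxE /=; ring. Qed.

Lemma mdot_cross x y z w :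
  mdot (cross x y) (cross z w) = mdot x w * mdot y z - mdot x z * mdot y w.
Proof. by rewrite !mdotE !mxE /=; ring. Qed.

Lemma crossZr k x y : cross x (k *: y) = k *: cross x y.
Proof. by apply: colvec3P; rewrite !mxE /=; ring. Qed.

Lemma cross_cramer a b c w : mdot (cross a b) c *: w =
  mdot (cross b c) w *: a + mdot (cross c a) w *: b + mdot (cross a b) w *: c.
Proof. by apply: colvec3P; rewrite !mdotE !mxE /=; ring. Qed.

Lemma cross_dual_cramer a b c w : mdot (cross a b) c *: w =
  mdot a w *: cross b c + mdot b w *: cross c a + mdot c w *: cross a b.
Proof. by apply: colvec3P; rewrite !mdotE !mxE /=; ring. Qed.

(** Two sides through [a] have normals whose own cross product is a multiple of [a], the factor
    being the determinant up to sign. *)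
Lemma cross_gram a b c :
  mdot (cross c a) (cross c a) * mdot (cross a b) (cross a b)
    - mdot (cross c a) (cross a b) ^+ 2
  = - mdot a a * mdot (cross a b) c ^+ 2.
Proof. by rewrite !mdotE !mxE /=; ring. Qed.

Lemma causal_cross_gt0 a b c : causal a -> causal b -> mdot (cross a b) c != 0 ->
  mdot a b < 0 /\ 0 < mdot (cross a b) (cross a b).
Proof.
move=> ca cb d0; have [_ a0] := ca; have [_ b0] := cb.
have ne : b 0 0 *: a <> a 0 0 *: b.
  move=> e; move/negP: d0; apply.
  have : a 0 0 * mdot (cross a b) c = 0.
    by rewrite -mdotZl -crossZr -e crossZr mdotZl mdot_crossC mdot_crossl mulr0.
  by move/eqP; rewrite mulf_eq0 gt_eqF.
have [ab lt] := causal_mdot_lt ca cb ne; split=> //.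
by rewrite mdot_cross (mdotC b a) -expr2 subr_gt0.
Qed.

Lemma causal_proportional a b : causal a -> causal b ->
  ~ 0 < mdot (cross a b) (cross a b) -> b = (b 0 0 / a 0 0) *: a.
Proof.
move=> ca cb ncr; have [_ a0] := ca.
have [e|ne] := pselect (b 0 0 *: a = a 0 0 *: b).
  by rewrite mulrC -scalerA e scalerA mulVf ?gt_eqF// scale1r.
have [_ lt] := causal_mdot_lt ca cb ne; case: ncr.
by rewrite mdot_cross (mdotC b a) -expr2 subr_gt0.
Qed.

Lemma spacelike_orthogonal a : exists2 n, 0 < mdot n n & mdot a n = 0.
Proof.
have [a12|a12] := eqVneq (a 1 0 ^+ 2 + a ord_max 0 ^+ 2) 0.
  exists (\col_i (i == 1)%:R); rewrite mdotE !mxE /=; first by lra.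
  move/eqP: a12; rewrite paddr_eq0 ?sqr_ge0// !sqrf_eq0 => /andP[/eqP -> _].
  by ring.
exists (\col_i (if i == 0 then 0 else if i == 1 then - a ord_max 0 else a 1 0)).
  have := addr_ge0 (sqr_ge0 (a 1 0)) (sqr_ge0 (a ord_max 0)).
  rewrite le_eqVlt eq_sym (negbTE a12) mdotE !mxE /=; lra.
by rewrite mdotE !mxE /=; ring.
Qed.

Definition collinear a b c := exists2 n, normal_through a b n & mdot c n = 0.

(** A nonzero cross product of two vertices would be the common normal; if all three vectors are
    proportional, any spacelike vector orthogonal to [a] is one. *)
Lemma noncollinear_cross a b c : causal a -> causal b -> causal c ->
  ~ collinear a b c -> mdot (cross a b) c != 0.
Proof.
move=> ca cb cc ncol; apply/negP => /eqP abc; apply: ncol.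
have [ab|ab] := pselect (0 < mdot (cross a b) (cross a b)).
  exists (cross a b); last by rewrite mdotC.
  by split; rewrite // mdotC ?mdot_crossl ?mdot_crossr.
have bE := causal_proportional ca cb ab.
have [ac|ac] := pselect (0 < mdot (cross a c) (cross a c)).
  exists (cross a c); last by rewrite mdotC mdot_crossr.
  split=> //; first by rewrite mdotC mdot_crossl.
  by rewrite bE mdotZl mdotC mdot_crossl mulr0.
have cE := causal_proportional ca cc ac.
have [n n0 an] := spacelike_orthogonal a.
by exists n; [split; rewrite // {1}bE|rewrite {1}cE]; rewrite mdotZl an mulr0.
Qed.

Definition cos_order p : R := if p is EFin k then cos (pi / k%:~R) else 1.

Lemma vertex_causal p a b c : vertex_of_order p a b c -> causal a.
Proof. by case: p => [k [/hplane_causal]| |]//; exact: ideal_causal. Qed.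

(** At a finite vertex the tangent directions have the same Gram matrix as the normals, up to the
    sign of the mixed term. At an ideal one [mdot a a = 0] makes the normals meet the Cauchy-Schwarz
    bound. *)
Lemma vertex_cross p a b c : causal b -> causal c ->
  mdot (cross a b) c != 0 -> vertex_of_order p a b c ->
  mdot (cross c a) (cross a b) =
    - cos_order p * (Num.sqrt (mdot (cross c a) (cross c a))
                     * Num.sqrt (mdot (cross a b) (cross a b))).
Proof.
move=> cb cc abc vp; have ca := vertex_causal vp.
have [ab P] := causal_cross_gt0 ca cb abc.
have [ca' Q] : mdot c a < 0 /\ 0 < mdot (cross c a) (cross c a).
  by apply: (causal_cross_gt0 cc ca (c := b)); rewrite mdot_crossC.
have gram := cross_gram a b c.
have ideal_case : ideal a -> mdot (cross c a) (cross a b) =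
    - 1 * (Num.sqrt (mdot (cross c a) (cross c a))
                     * Num.sqrt (mdot (cross a b) (cross a b))).
  move=> [aa _]; rewrite !mdot_cross aa mul0r !mulr0 (mdotC a c) (mdotC b a) !subr0 sub0r.
  by rewrite -!expr2 !sqrtr_sqr !ltr0_norm//; ring.
case: p vp => [k [[aa _] ang]| |] //=.
have vv : mdot (direction a b) (direction a b) = mdot (cross a b) (cross a b).
  by rewrite /direction mdot_cross !mdot_lin aa (mdotC b a); ring.
have ww : mdot (direction a c) (direction a c) = mdot (cross c a) (cross c a).
  by rewrite /direction mdot_cross !mdot_lin aa (mdotC c a); ring.
have vw : mdot (direction a b) (direction a c) = - mdot (cross c a) (cross a b).
  by rewrite /direction mdot_cross !mdot_lin aa (mdotC c a) (mdotC c b) (mdotC b a); ring.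
move: ang; rewrite /angle vv ww vw.
set M := mdot (cross c a) (cross a b) in gram *.
set A := mdot (cross a b) (cross a b) in gram P *.
set B := mdot (cross c a) (cross c a) in gram Q *.
have sA : 0 < Num.sqrt A by rewrite sqrtr_gt0.
have sB : 0 < Num.sqrt B by rewrite sqrtr_gt0.
(* [acos] is inverted by [cos] only on this range; [cross_gram] provides the bound. *)
have AB : `|- M / (Num.sqrt A * Num.sqrt B)| <= 1.
  rewrite normf_div normrN (gtr0_norm (mulr_gt0 sA sB)) ler_pdivrMr ?mulr_gt0// mul1r.
  rewrite -(ler_pXn2r (n := 2))// ?nnegrE ?mulr_ge0 ?(ltW sA) ?(ltW sB)//.
  rewrite exprMn !sqr_sqrtr ?(ltW P) ?(ltW Q)// -normrX ger0_norm ?sqr_ge0//.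
  by have := sqr_ge0 (mdot (cross a b) c); move: gram; rewrite aa; lra.
move=> /(congr1 cos); rewrite acosK; last by rewrite in_itv/= -ler_norml.
move=> <-; field; by rewrite !gt_eqF.
Qed.

Lemma dihedral_cos_order p a b : (2%:E <= p)%E -> mdot a b = - cos_order p ->
  dihedral_pair a b.
Proof.
case: p => [k| |] //=; last by left.
rewrite lee_fin => k2 E; right; rewrite E.
by case: k k2 {E} => // k k2; exists k.
Qed.

Definition root_triple n1 n2 n3 := [/\ mdot n1 n1 = 1, mdot n2 n2 = 1, mdot n3 n3 = 1,
  forall w, chamber [:: n1; n2; n3] w -> 0 <= w 0 0 &
  forall k1 k2 k3, k1 *: n1 + k2 *: n2 + k3 *: n3 = 0 -> [/\ k1 = 0, k2 = 0 & k3 = 0]].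

Lemma triangle_roots p q r a b c : hyperbolic_triangle p q r a b c ->
  exists n1 n2 n3, [/\ root_triple n1 n2 n3,
    mdot n2 n3 = - cos_order p, mdot n1 n3 = - cos_order q, mdot n1 n2 = - cos_order r &
    side_reflections a b c = [set reflection s | s in [set` [:: n1; n2; n3]]]%classic].
Proof.
move=> [va vb vc ncol].
have ca := vertex_causal va; have cb := vertex_causal vb; have cc := vertex_causal vc.
have abc0 := noncollinear_cross ca cb cc ncol.
set d := mdot (cross a b) c in abc0.
have bca : mdot (cross b c) a = d by rewrite -mdot_crossC.
have cab : mdot (cross c a) b = d by rewrite -mdot_crossC bca.
have [_ N3] := causal_cross_gt0 ca cb abc0.
have bca0 : mdot (cross b c) a != 0 by rewrite bca.
have cab0 : mdot (cross c a) b != 0 by rewrite cab.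
have [_ N1] := causal_cross_gt0 cb cc bca0.
have [_ N2] := causal_cross_gt0 cc ca cab0.
(* The orientation of the triangle; this sign turns all three normals inward. *)
pose s := Num.sg d; have ss : s * s = 1 by rewrite -expr2 sqr_sg abc0.
pose unit_normal x := (s / Num.sqrt (mdot x x)) *: x.
have unitE x y : 0 < mdot x x -> 0 < mdot y y ->
    mdot (unit_normal x) (unit_normal y)
    = mdot x y / (Num.sqrt (mdot x x) * Num.sqrt (mdot y y)).
  move=> x0 y0; rewrite !mdot_lin.
  transitivity (s * s * mdot x y / (Num.sqrt (mdot x x) * Num.sqrt (mdot y y))).
    by field; rewrite !gt_eqF ?sqrtr_gt0.
  by rewrite ss mul1r.
have unit1 x : 0 < mdot x x -> mdot (unit_normal x) (unit_normal x) = 1.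
  by move=> x0; rewrite unitE// -expr2 sqr_sqrtr ?ltW// divff// gt_eqF.
have gram x y t : 0 < mdot x x -> 0 < mdot y y ->
    mdot x y = - t * (Num.sqrt (mdot x x) * Num.sqrt (mdot y y)) ->
    mdot (unit_normal x) (unit_normal y) = - t.
  by move=> x0 y0 E; rewrite unitE// E; field; rewrite !gt_eqF ?sqrtr_gt0.
exists (unit_normal (cross b c)), (unit_normal (cross c a)), (unit_normal (cross a b)).
have sign x w : 0 < mdot x x -> 0 <= mdot (unit_normal x) w -> 0 <= s * mdot x w.
  move=> x0; rewrite mdotZl mulrAC => h; rewrite -(pmulr_lge0 _ (x := (Num.sqrt (mdot x x))^-1))//.
  by rewrite invr_gt0 sqrtr_gt0.
have nz x : 0 < mdot x x -> s / Num.sqrt (mdot x x) != 0.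
  move=> x0; apply: mulf_neq0; first by rewrite /s sgr_eq0.
  by rewrite invr_eq0 gt_eqF ?sqrtr_gt0.
split.
- split; try exact: unit1.
  + move=> w wC.
    have h1 := sign _ w N1 (wC _ (mem_head _ _)).
    have h2 : 0 <= s * mdot (cross c a) w by apply: sign => //; apply: wC; rewrite !inE eqxx orbT.
    have h3 : 0 <= s * mdot (cross a b) w by apply: sign => //; apply: wC; rewrite !inE eqxx !orbT.
    have [[_ a0] [_ b0] [_ c0]] := And3 ca cb cc.
    have sd : 0 < s * d by rewrite /s -normrEsg normr_gt0.
    rewrite -(pmulr_rge0 _ sd).
    (* By Cramer's rule a point of the chamber is a nonnegative combination of the future vectors
       [a], [b], [c]. *)
    have := congr1 (fun t : 'cV[R]_3 => t 0 0) (cross_cramer a b c w); rewrite !mxE -/d => E.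
    rewrite -mulrA E !mulrDr !mulrA.
    by rewrite !addr_ge0// mulr_ge0// ltW.
  + move=> t1 t2 t3 E.
    have E' x : t1 * mdot (unit_normal (cross b c)) x + t2 * mdot (unit_normal (cross c a)) x
        + t3 * mdot (unit_normal (cross a b)) x = 0.
      by rewrite -!mdotZl -!mdotDl E mdot0l.
    split.
    * move: (E' a); rewrite !mdotZl mdot_crossr mdot_crossl !mulr0 !addr0 => /eqP.
      by rewrite mulf_eq0 (negbTE (mulf_neq0 (nz _ N1) bca0)) orbF => /eqP.
    * move: (E' b); rewrite !mdotZl mdot_crossr mdot_crossl !mulr0 addr0 add0r => /eqP.
      by rewrite mulf_eq0 (negbTE (mulf_neq0 (nz _ N2) cab0)) orbF => /eqP.
    * move: (E' c); rewrite !mdotZl mdot_crossr mdot_crossl !mulr0 !add0r => /eqP.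
      by rewrite mulf_eq0 (negbTE (mulf_neq0 (nz _ N3) abc0)) orbF => /eqP.
- by apply: gram => //; apply: vertex_cross.
- by rewrite mdotC; apply: gram => //; apply: vertex_cross.
- by apply: gram => //; apply: vertex_cross.
- have through x y z n : 0 < mdot (cross x y) (cross x y) -> mdot (cross x y) z != 0 ->
      normal_through x y n -> reflection n = reflection (unit_normal (cross x y)).
    move=> xy0 xyz [n0 xn yn].
    have nE : n = (mdot z n / mdot (cross x y) z) *: cross x y.
      rewrite mulrC -scalerA; apply: (scalerI xyz); rewrite (scalerA (mdot (cross x y) z)) mulfV// scale1r.
      by rewrite (cross_dual_cramer x y z) xn yn !scale0r !add0r.
    have xy1 : mdot (cross x y) (cross x y) != 0 by rewrite gt_eqF.
    rewrite /unit_normal (reflectionZ (nz _ xy0) xy1) nE reflectionZ//.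
    by apply/eqP => t0; move: n0; rewrite nE t0 scale0r mdot0l ltxx.
  have normal x y : 0 < mdot (cross x y) (cross x y) ->
      normal_through x y (unit_normal (cross x y)).
    move=> xy0; split; first by rewrite unit1.
      by rewrite mdotZr mdotC mdot_crossl mulr0.
    by rewrite mdotZr mdotC mdot_crossr mulr0.
  apply/seteqP; split=> [_ [n [[nT|nT]|nT] <-]|_ [n /= nS <-]].
  + exists (unit_normal (cross a b)); first by rewrite /= !inE eqxx !orbT.
    by rewrite (through a b c).
  + exists (unit_normal (cross b c)); first by rewrite /= !inE eqxx.
    by rewrite (through b c a).
  + exists (unit_normal (cross c a)); first by rewrite /= !inE eqxx !orbT.
    by rewrite (through c a b).
  + exists n => //; move: nS; rewrite !inE => /or3P[]/eqP->.
    * by left; right; exact: normal.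
    * by right; exact: normal.
    * by left; left; exact: normal.
Qed.

End Triangle.

(** * The orders of the vertices *)

Section Conclusion.
Variable R : realType.
Implicit Types (p q r : \bar int) (a b c : 'cV[R]_3) (x y z : R).

Lemma root_triple_figure_eight (n1 n2 n3 : 'cV[R]_3) x y z :
  root_triple n1 n2 n3 ->
  mdot n2 n3 = - x -> mdot n1 n3 = - y -> mdot n1 n2 = - z ->
  dihedral_pair n2 n3 -> dihedral_pair n1 n3 -> dihedral_pair n1 n2 ->
  0 <= y -> 0 <= z -> 1 < x + 2 * y * z ->
  z < (x + 2 * y * z) * y -> y < (x + 2 * y * z) * z ->
  1 < (x + 2 * y * z) * x + 2 * z ^+ 2 -> 1 < (x + 2 * y * z) * x + 2 * y ^+ 2 ->
  exists g, figure_eight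
    [set h | reflection_group [:: n1; n2; n3] h /\ 0 < \det h]%classic g.
Proof.
move=> [n11 n22 n33 future free] n23 n13 n12 d23 d13 d12 y0 z0.
set k := x + 2 * y * z => k1 zky ykz kxz kxy.
pose e := Num.sqrt (k ^+ 2 - 1).
have e0 : 0 < e by rewrite sqrtr_gt0 subr_gt0 exprn_egt1.
have ee : e ^+ 2 = k ^+ 2 - 1 by rewrite sqr_sqrtr// ltW// -sqrtr_gt0.
eexists; apply: (figure_eight_reflections n11 n22 n33 n12 n13 n23 d12 d13 d23
  (erefl k) y0 z0 k1 zky ykz kxz kxy future free e0 ee
  erefl erefl erefl erefl erefl erefl erefl erefl erefl erefl).
Qed.

Lemma cos_order_lt p q : (2%:E <= p)%E -> (p < q)%E -> cos_order R p < cos_order R q.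
Proof.
have itv (k : int) : 2 <= k -> pi / k%:~R \in `[0 : R, pi].
  move=> k2; have k1 : 1 <= k%:~R :> R by rewrite ler1z; lia.
  have k0 : 0 < k%:~R :> R by lra.
  rewrite in_itv/=; apply/andP; split; first by apply: divr_ge0; [exact: pi_ge0|exact: ltW].
  by rewrite ler_pdivrMr// ler_peMr ?pi_ge0.
case: p => [k||//]; last by move=> _; rewrite ltNge leey.
rewrite lee_fin => k2; case: q => [l| |]//=.
  rewrite lte_fin => kl; have l2 : 2 <= l by lia.
  rewrite ltr_cos ?itv// ltr_pM2l ?pi_gt0// ltf_pV2 ?posrE ?ltr0z ?ltr_int//; lia.
move=> _; rewrite -[ltRHS]cos0 ltr_cos ?itv//; last by rewrite in_itv/= lexx pi_ge0.
by rewrite divr_gt0 ?pi_gt0// ltr0z; lia.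
Qed.

Lemma cos_order_le p q : (2%:E <= p)%E -> (p <= q)%E -> cos_order R p <= cos_order R q.
Proof.
by move=> p2; rewrite le_eqVlt => /orP[/eqP->//|/(cos_order_lt p2)/ltW].
Qed.

Lemma cos_order_le1 p : cos_order R p <= 1.
Proof. by case: p => *; rewrite /= ?cos_le1. Qed.

Lemma cos_order2 : cos_order R 2%:E = 0.
Proof. exact: cos_pihalf. Qed.

(** From cos 3t = -1, since [4 * c ^+ 3 - 3 * c + 1] factors as [(c + 1) * (2 * c - 1) ^+ 2]. *)
Lemma cos_order3 : cos_order R 3%:E = 1 / 2.
Proof.
have c0 : cos_order R 2%:E < cos_order R 3%:E by apply: cos_order_lt.
rewrite cos_order2 /= in c0 *; set t := pi / 3%:~R in c0 *; set c := cos t in c0 *.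
have : cos (t *+ 2 + t) = -1.
  by rewrite -mulrSr -mulr_natr divfK ?cospi// pnatr_eq0.
rewrite cosD cos_mulr2n sin_mulr2n -/c => E.
have s2 : sin t * sin t = 1 - c ^+ 2 by rewrite -expr2 sin2cos2.
have : (c + 1) * (2 * c - 1) ^+ 2 = 0.
  transitivity (1 + ((c ^+ 2 *+ 2 - 1) * c - (c * (sin t * sin t)) *+ 2)).
    by rewrite s2; ring.
  apply/eqP; rewrite addrC addr_eq0; apply/eqP; apply: etrans E; ring.
move/eqP; rewrite mulf_eq0 sqrf_eq0 => /orP[] /eqP; lra.
Qed.

Lemma cos_order4_sqr : cos_order R 4%:E ^+ 2 = 1 / 2.
Proof.
rewrite /=; set t := pi / 4%:~R.
have : cos (t *+ 2) = 0.
  by rewrite -cos_pihalf; congr cos; rewrite -mulr_natr /t; field.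
rewrite cos_mulr2n; lra.
Qed.

(** The bound [1 / 2] is the squared cosine for order 4, where the inequalities degenerate to
    equalities if [x = 0]; hence the alternative. Exchanging [y] and [z] gives the remaining two. *)
Lemma figure_eight_inequalities x y z : 0 <= x -> 0 < y -> 0 < z ->
  1 / 2 <= y ^+ 2 -> 1 / 2 <= z ^+ 2 ->
  0 < x \/ (1 / 2 < y ^+ 2 /\ 1 / 2 < z ^+ 2) ->
  [/\ 1 < x + 2 * y * z, z < (x + 2 * y * z) * y & 1 < (x + 2 * y * z) * x + 2 * z ^+ 2].
Proof.
move=> x0 y0 z0 y2 z2 H.
have yz : 0 < y * z by rewrite mulr_gt0.
have xy : 0 <= x * y by rewrite mulr_ge0// ltW.
have yz2 : 1 / 4 <= (y * z) ^+ 2 by rewrite exprMn; nra.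
have yz12 : 1 / 2 <= y * z by nra.
have zy2 : z * (1 / 2) <= z * y ^+ 2 by rewrite ler_pM2l.
case: H => [x_gt0|[y2' z2']].
  have xy_gt0 : 0 < x * y by rewrite mulr_gt0.
  have xyz : 0 < x * (y * z) by rewrite mulr_gt0.
  by have := sqr_ge0 x; split; lra.
have yz2' : 1 / 4 < (y * z) ^+ 2 by rewrite exprMn; nra.
have yz12' : 1 / 2 < y * z by nra.
have zy2' : z * (1 / 2) < z * y ^+ 2 by rewrite ltr_pM2l.
have xyz : 0 <= x * (y * z) by rewrite mulr_ge0// ltW.
by have := sqr_ge0 x; split; lra.
Qed.

Lemma order_cases p q r : (2%:E <= p)%E -> (p <= q)%E -> (q <= r)%E ->
  order_inv R p + order_inv R q + order_inv R r < 1 -> ~ exceptional p q r ->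
  [\/ (4%:E < q)%E, (3%:E <= p)%E /\ (4%:E <= q)%E |
      [/\ p = 3%:E, q = 3%:E & (4%:E <= r)%E]].
Proof.
move=> p2 pq qr sum nex.
have [q5|q4] := ltP 4%:E%E q; first by constructor 1.
have r0 : 0 <= order_inv R r.
  case: r qr {sum nex} => [l| |]//=; rewrite invr_ge0 ler0z.
  move=> qr; have := le_trans (le_trans p2 pq) qr; rewrite lee_fin; lia.
case: q pq qr sum nex q4 => [l| |]//; case: p p2 => [k| |]//.
rewrite !lee_fin => k2 kl lr sum nex l4.
have klE : [\/ k = 2 /\ l = 2, k = 2 /\ (l = 3 \/ l = 4), 3 <= k /\ l = 4 | k = 3 /\ l = 3].
  have [->|k3] := eqVneq k 2.
    have [->|l2] := eqVneq l 2; first by constructor 1.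
    by constructor 2; split=> //; lia.
  have [->|l3] := eqVneq l 4; first by constructor 3; lia.
  by constructor 4; lia.
case: klE => [[kE lE]|[kE lE]|[k3 lE]|[kE lE]].
- by move: sum; rewrite kE lE /=; lra.
- by case: nex; rewrite kE; split=> //; case: lE => ->; [left|right].
- by constructor 2; rewrite lE.
- constructor 3; rewrite kE lE; split=> //.
  case: r lr sum {nex r0} => [j||] lr sum; [|by rewrite leey|by []].
  move: lr; rewrite !lee_fin lE => j3; have [jE|j4] := eqVneq j 3; last by lia.
  by exfalso; move: sum; rewrite kE lE jE /=; lra.
Qed.

End Conclusion.

Theorem corollary4p4 (R : realType) (p q r : \bar int) (a b c : 'cV[R]_3) :
  (2%:E <= p)%E -> (p <= q)%E -> (q <= r)%E ->
  order_inv R p + order_inv R q + order_inv R r < 1 ->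
  ~ exceptional p q r ->
  hyperbolic_triangle p q r a b c ->
  exists g : 'M[R]_3, figure_eight (triangle_group a b c) g.
Proof.
move=> p2 pq qr sum nex /triangle_roots[n1 [n2 [n3 [roots n23 n13 n12 sides]]]].
have q2 := le_trans p2 pq; have r2 := le_trans q2 qr.
have d23 := dihedral_cos_order p2 n23.
have d13 := dihedral_cos_order q2 n13.
have d12 := dihedral_cos_order r2 n12.
have cos_ge0 t : (2%:E <= t)%E -> 0 <= cos_order R t.
  by move=> t2; rewrite -(cos_order2 R) cos_order_le.
have c4 := cos_order4_sqr R.
have c4_gt0 : 0 < cos_order R 4%:E.
  by rewrite -(cos_order2 R); exact: cos_order_lt.
have sqr4 t : (4%:E <= t)%E -> 0 < cos_order R t /\ 1 / 2 <= cos_order R t ^+ 2.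
  move=> t4; have := cos_order_le R (p := 4%:E) isT t4; rewrite -c4 => le.
  by split; [exact: lt_le_trans le|rewrite ler_pXn2r// nnegrE ?cos_ge0//; exact: le_trans t4].
have big_q : (4%:E <= q)%E ->
    0 < cos_order R p \/ 1 / 2 < cos_order R q ^+ 2 /\ 1 / 2 < cos_order R r ^+ 2 ->
    exists g : 'M[R]_3, figure_eight (triangle_group a b c) g.
  move=> q4 H; have [y0 y2] := sqr4 q q4; have [z0 z2] := sqr4 r (le_trans q4 qr).
  have x0 := cos_ge0 p p2.
  have [h1 h2 h3] := figure_eight_inequalities x0 y0 z0 y2 z2 H.
  have H' : 0 < cos_order R p \/ 1 / 2 < cos_order R r ^+ 2 /\ 1 / 2 < cos_order R q ^+ 2.
    by case: H => [|[]]; [left|right].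
  have [_ h4 h5] := figure_eight_inequalities x0 z0 y0 z2 y2 H'.
  rewrite mulrAC in h4; rewrite mulrAC in h5.
  rewrite /triangle_group sides.
  exact: root_triple_figure_eight roots n23 n13 n12 d23 d13 d12 (ltW y0) (ltW z0) h1 h2 h4 h3 h5.
have [q5|[p3 q4]|[pE qE r4]] := order_cases p2 pq qr sum nex.
- apply: big_q; first exact: ltW.
  have sqr5 t : (4%:E < t)%E -> 1 / 2 < cos_order R t ^+ 2.
    move=> t5; rewrite -c4 ltr_pXn2r ?nnegrE ?cos_ge0//; first exact: cos_order_lt.
    exact: le_trans (ltW t5).
  by right; split; apply: sqr5 => //; exact: lt_le_trans qr.
- apply: big_q => //; left; rewrite -(cos_order2 R).
  by apply: cos_order_lt => //; exact: lt_le_trans p3.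
(* For orders 3, 3, r the curve around the vertices of orders q and r fails: the
   feet of the common perpendicular leave the sides. *)
have [x0 x2] := sqr4 r r4.
have c3 := cos_order3 R.
rewrite pE c3 in n23; rewrite qE c3 in n13; set x := cos_order R r in x0 x2 n12.
(* With [k = x + 1 / 2], all five inequalities follow from this. *)
have x_half : 1 / 2 < x by nra.
have x1 : x <= 1 := cos_order_le1 R r.
rewrite /triangle_group sides.
(* The cyclic relabelling makes ab, the side between the vertices of order 3, the side that is
   crossed. *)
have -> : ([set` [:: n1; n2; n3]] = [set` [:: n3; n1; n2]])%classic.
  by apply/seteqP; split=> s /=; rewrite !inE => /or3P[]->; rewrite ?orbT.
have roots' : root_triple n3 n1 n2.
  have [n11 n22 n33 future free] := roots; split=> //.
    move=> w wC; apply: future => s sS; apply: wC; move: sS.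
    by rewrite !inE => /or3P[]->; rewrite ?orbT.
  by move=> k1 k2 k3; rewrite -addrA addrC => /free[].
have half : 0 <= 1 / 2 :> R by lra.
apply: (root_triple_figure_eight roots' n12 (y := 1 / 2) (z := 1 / 2)) => //;
  rewrite 1?mdotC//; try exact: dihedral_pairC; nra.
Qed.
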